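(* Let $k$ be a field and let $E$ be any finite quiver having at least one non-trivial closed path. Then the $k$-algebras $L_\infty\otimes L(E)$ and $L(E)$ are not Morita equivalent. Similarly, $L_\infty\otimes L_\infty$ and $L_\infty$ are not Morita equivalent.
   Context: All algebras and tensor products are over the field $k$. Morita equivalence of unital $k$-algebras $R,S$ is understood over $k$, i.e. implemented by an $R\otimes S^{op}$-module $P$ and an $S\otimes R^{op}$-module $Q$. $L_\infty$ is the unital $k$-algebra presented by generators $x_1,x_1^*,x_2,x_2^*,\dots$ and relations $x_i^*x_j=\delta_{i,j}1$ for all $i,j\ge1$. A finite quiver $E=(E_0,E_1,r,s)$ has finite sets $E_0$ of vertices and $E_1$ of arrows, and range and source maps $r,s:E_1\to E_0$. A sink is a vertex that is not the source of any arrow; $\mathrm{Sink}(E)$ is the set of sinks. Paths $\alpha_1\cdots\alpha_l$ satisfy $r(\alpha_i)=s(\alpha_{i+1})$; a non-trivial closed path is a path of length $\ge1$ whose source and range coincide. Leavitt path algebra: let $\hat E$ be the quiver obtained from $E$ by adding, for each $\alpha\in E_1$, an arrow $\alpha^*$ in the opposite direction ($s(\alpha^* )=r(\alpha)$, $r(\alpha^* )=s(\alpha)$). $L(E)$ is the $k$-algebra with generators $p_i$ ($i\in E_0$) and $\alpha\in\hat E_1$, and relations: $p_ip_j=\delta_{i,j}p_i$ ($i,j\in E_0$); $p_{s(\alpha)}\alpha=\alpha=\alpha p_{r(\alpha)}$ ($\alpha\in\hat E_1$); $\alpha^*\beta=\delta_{\alpha,\beta}p_{r(\alpha)}$ ($\alpha,\beta\in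 E_1$); $p_i=\sum_{\alpha\in E_1,\,s(\alpha)=i}\alpha\alpha^*$ ($i\in E_0\setminus\mathrm{Sink}(E)$). It is unital with unit $\sum_{i\in E_0}p_i$. *)

(* Defs.v *)
(* Built on MathComp (algebra), with boolp for classical reasoning and monalg *)
(* (multinomials) for free abelian groups and free algebras.                  *)
From HB Require Import structures.
From mathcomp Require Import all_boot all_order all_algebra.
From mathcomp Require Import boolp.
From mathcomp Require Import ring_quotient finmap.
From mathcomp.multinomials Require Import monalg.

Set Implicit Arguments.
Unset Strict Implicit.
Unset Printing Implicit Defensive.

Import GRing.Theory.
Local Open Scope ring_scope.
Local Open Scope quotient_scope.

(* Unital associative k-algebras: rings with a central unital ring morphism   *)
(* c |-> c.1 from k, so that c.x is kscal c * x. MathComp's algType is not    *)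
(* used because it requires 1 != 0, which an algebra given by generators and  *)
(* relations need not satisfy (L(E) is zero when E has no vertices).          *)
HB.mixin Record isKAlgebra (k : pzRingType) A of GRing.PzRing A := {
  kscal : k -> A;
  kscal1 : kscal 1 = 1;
  kscalB : {morph kscal : c d / c - d};
  kscalM : {morph kscal : c d / c * d};
  kscalC : forall c x, kscal c * x = x * kscal c
}.
#[short(type="kalgType")]
HB.structure Definition KAlgebra (k : pzRingType) :=
  {A of GRing.PzRing A & isKAlgebra k A}.

Section Opposite.
Variables (k : comPzRingType) (A : kalgType k).

Let kscal_op : k -> A^c := @kscal k A.

Fact kscalM_op : {morph kscal_op : c d / c * d}.
Proof. by move=> c d; rewrite /kscal_op mulrC kscalM. Qed.

Fact kscalC_op c (x : A^c) : kscal_op c * x = x * kscal_op c.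
Proof. exact: esym (@kscalC k A c x). Qed.

HB.instance Definition _ :=
  isKAlgebra.Build k A^c kscal1 kscalB kscalM_op kscalC_op.

End Opposite.

Fact morphB_morphD (V W : zmodType) (f : V -> W) :
  {morph f : x y / x - y} -> {morph f : x y / x + y}.
Proof.
move=> fB x y; have f0 : f 0 = 0 by rewrite -(subrr 0) fB subrr.
by rewrite -{1}[y]opprK fB -[- y]sub0r fB f0 sub0r opprK.
Qed.

(* The quotient of an abelian group V by the subgroup generated by X.         *)
Section SubgroupQuotient.
Variables (V : zmodType) (X : V -> Prop).

Inductive subgroup : V -> Prop :=
| subgroup_gen x of X x : subgroup x
| subgroup0 : subgroup 0
| subgroupB x y of subgroup x & subgroup y : subgroup (x - y).

Definition in_subgroup : V -> bool := fun x => `[< subgroup x >].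

Fact in_subgroup_zmod_closed : zmod_closed in_subgroup.
Proof.
split=> [|x y /asboolP Hx /asboolP Hy]; apply/asboolP; first exact: subgroup0.
exact: subgroupB.
Qed.

HB.instance Definition _ :=
  GRing.isZmodClosed.Build V in_subgroup in_subgroup_zmod_closed.

Definition subgroup_zmod : zmodClosed V := GRing.ZmodClosed.clone V in_subgroup _.

Definition zquot : Type := Quotient.quot subgroup_zmod.
HB.instance Definition _ := GRing.Zmodule.on zquot.

Definition zpi (x : V) : zquot := \pi_(Quotient.quot subgroup_zmod) x.

Fact zpiB : {morph zpi : x y / x - y}.
Proof. by move=> x y; rewrite /zpi raddfB. Qed.

HB.instance Definition _ := GRing.isZmodMorphism.Build V zquot zpi zpiB.

Definition zrepr (t : zquot) : V := repr (t : Quotient.quot subgroup_zmod).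

Lemma zreprK : cancel zrepr zpi.
Proof. by move=> t; rewrite /zpi reprK. Qed.

Lemma zpi_eq x y : zpi x = zpi y <-> subgroup (x - y).
Proof.
split=> [/eqP|H]; first by rewrite /zpi -Quotient.idealrBE => /asboolP.
by apply/eqP; rewrite /zpi -Quotient.idealrBE; apply/asboolP.
Qed.

End SubgroupQuotient.

(* Keeps unification from unfolding quotients; no effect on conversion. *)
#[global] Opaque zquot zpi zrepr.

(* The tensor product over S of a right S-module P and a left S-module Q,     *)
(* given by their actions ra and la: the free abelian group on P * Q modulo   *)
(* biadditivity and S-balancedness.                                           *)
Section Tensor.
Variables (P Q : zmodType) (S : Type) (ra : P -> S -> P) (la : S -> Q -> Q).

Local Notation free := {malg int[(P * Q)%type]}.

Inductive tens_rel : free -> Prop :=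
| tens_relDl p p' q : tens_rel (<< (p + p', q) >> - << (p, q) >> - << (p', q) >>)
| tens_relDr p q q' : tens_rel (<< (p, q + q') >> - << (p, q) >> - << (p, q') >>)
| tens_relZ p s q : tens_rel (<< (ra p s, q) >> - << (p, la s q) >>).

Definition tens : Type := zquot tens_rel.
HB.instance Definition _ := GRing.Zmodule.on tens.

Definition pure (p : P) (q : Q) : tens := zpi tens_rel << (p, q) >>.

Lemma pureDl p p' q : pure (p + p') q = pure p q + pure p' q.
Proof.
rewrite /pure -raddfD; apply/zpi_eq; rewrite opprD addrA.
exact/subgroup_gen/tens_relDl.
Qed.

Lemma pureDr p q q' : pure p (q + q') = pure p q + pure p q'.
Proof.
rewrite /pure -raddfD; apply/zpi_eq; rewrite opprD addrA.
exact/subgroup_gen/tens_relDr.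
Qed.

Lemma pureZ p s q : pure (ra p s) q = pure p (la s q).
Proof. exact/zpi_eq/subgroup_gen/tens_relZ. Qed.

Lemma tens_ind (C : tens -> Prop) :
  (forall p q, C (pure p q)) -> (forall t u, C t -> C u -> C (t - u)) ->
  forall t, C t.
Proof.
move=> Cp CB t; rewrite -[t]zreprK; move: (zrepr t) => x.
have C0 : C 0 by have := CB _ _ (Cp 0 0) (Cp 0 0); rewrite subrr.
have CN u : C u -> C (- u) by move=> Cu; rewrite -[- u]sub0r; apply: CB.
have CD u v : C u -> C v -> C (u + v).
  by move=> Cu /CN Cv; rewrite -[v]opprK; apply: CB.
rewrite [x]monalgE raddf_sum /=; elim/big_ind: _ => // -[p q] _.
move: (x@_ _) => c; have CMn n : C (zpi tens_rel << n%:Z *g (p, q) >>).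
  elim: n => [|n IHn]; first by rewrite monalgU0 raddf0.
  rewrite -addn1 PoszD monalgUD raddfD; apply: CD => //; exact: Cp.
by case: c => n; [exact: CMn | rewrite NegzE monalgUN raddfN; exact/CN/CMn].
Qed.

(* The universal property of the tensor product. *)
Section Lift.
Variables (V : zmodType) (f : P -> Q -> V).

Definition free_lift (x : free) : V :=
  \sum_(pq <- msupp x) f pq.1 pq.2 *~ x@_pq.

Definition tens_lift (t : tens) : V :=
  free_lift (zrepr t).

Hypothesis fDl : forall p p' q, f (p + p') q = f p q + f p' q.
Hypothesis fDr : forall p q q', f p (q + q') = f p q + f p q'.
Hypothesis fZ : forall p s q, f (ra p s) q = f p (la s q).

Lemma free_liftEw (d : {fset (P * Q)%type}) x : (msupp x `<=` d)%fset ->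
  free_lift x = \sum_(pq <- d) f pq.1 pq.2 *~ x@_pq.
Proof.
move=> le; apply/big_fset_incl => // pq _ /mcoeff_outdom ->.
exact: mulr0z.
Qed.

Lemma free_liftB : {morph free_lift : x y / x - y}.
Proof.
move=> x y; set d := (msupp x `|` msupp y)%fset.
rewrite (@free_liftEw d x) ?(@free_liftEw d y) ?fsubsetUl ?fsubsetUr //.
rewrite (@free_liftEw d (x - y)) ?msuppB_le // -sumrB.
by apply: eq_bigr => pq _; rewrite mcoeffB mulrzBr.
Qed.

HB.instance Definition _ :=
  GRing.isZmodMorphism.Build free V free_lift free_liftB.

Lemma free_liftU p q : free_lift << (p, q) >> = f p q.
Proof.
rewrite (@free_liftEw [fset (p, q)]%fset) ?msuppU_le //.
by rewrite big_seq_fset1 mcoeffUU mulr1z.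
Qed.

Lemma free_lift_zpi x : tens_lift (zpi tens_rel x) = free_lift x.
Proof.
have H y : subgroup tens_rel y -> free_lift y = 0.
  elim=> [_ []||{}y z _ Hy _ Hz] *; last by rewrite raddfB /= Hy Hz subrr.
  - by rewrite !raddfB /= !free_liftU fDl addrAC addrK subrr.
  - by rewrite !raddfB /= !free_liftU fDr addrAC addrK subrr.
  - by rewrite !raddfB /= !free_liftU fZ subrr.
  - by rewrite raddf0.
apply/eqP; rewrite -subr_eq0 -raddfB; apply/eqP/H/zpi_eq.
exact: zreprK.
Qed.

Lemma tens_liftB : {morph tens_lift : t u / t - u}.
Proof.
move=> t u; rewrite -[t]zreprK -[u]zreprK.
by rewrite -raddfB !free_lift_zpi raddfB.
Qed.

Lemma tens_liftE p q : tens_lift (pure p q) = f p q.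
Proof. by rewrite free_lift_zpi free_liftU. Qed.

End Lift.
End Tensor.

(* The k-algebra A (x)_k B. *)
Section TensorAlgebra.
Variables (k : comPzRingType) (A B : kalgType k).

Definition kactr (a : A) (c : k) : A := kscal c * a.
Definition kactl (c : k) (b : B) : B := kscal c * b.

Definition tensA : Type := tens kactr kactl.
HB.instance Definition _ := GRing.Zmodule.on tensA.

Definition pureA (a : A) (b : B) : tensA := pure kactr kactl a b.

Definition tensA_mul_pure (a : A) (b : B) (u : tensA) : tensA :=
  tens_lift (fun a' b' => pureA (a * a') (b * b')) u.

Definition tensA_mul (t u : tensA) : tensA :=
  tens_lift (fun a b => tensA_mul_pure a b u) t.

Fact tensA_mul_pure_balanced a b (f := fun a' b' => pureA (a * a') (b * b')) :
  [/\ forall a1 a2 b', f (a1 + a2) b' = f a1 b' + f a2 b',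
      forall a' b1 b2, f a' (b1 + b2) = f a' b1 + f a' b2 &
      forall a' c b', f (kactr a' c) b' = f a' (kactl c b')].
Proof.
split=> [a1 a2 b'|a' b1 b2|a' c b']; rewrite /f.
- by rewrite mulrDr /pureA pureDl.
- by rewrite mulrDr /pureA pureDr.
- by rewrite /kactr /kactl !mulrA -!(kscalC c) -!mulrA; exact: pureZ.
Qed.

Fact tensA_mul_pureB a b : {morph tensA_mul_pure a b : t u / t - u}.
Proof.
by have [fDl fDr fZ] := tensA_mul_pure_balanced a b; apply: tens_liftB.
Qed.

Fact tensA_mul_pureE a b a' b' :
  tensA_mul_pure a b (pureA a' b') = pureA (a * a') (b * b').
Proof.
have [fDl fDr fZ] := tensA_mul_pure_balanced a b.
exact: (tens_liftE fDl fDr fZ).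
Qed.

Fact tensA_mul_balanced u (f := fun a b => tensA_mul_pure a b u) :
  [/\ forall a a' b, f (a + a') b = f a b + f a' b,
      forall a b b', f a (b + b') = f a b + f a b' &
      forall a c b, f (kactr a c) b = f a (kactl c b)].
Proof.
split=> [a1 a2 b|a b1 b2|a c b]; rewrite /f;
  elim/tens_ind: u @f => [a' b'|u v IHu IHv].
- by rewrite !tensA_mul_pureE mulrDl /pureA pureDl.
- by rewrite !tensA_mul_pureB IHu IHv opprD addrACA.
- by rewrite !tensA_mul_pureE mulrDl /pureA pureDr.
- by rewrite !tensA_mul_pureB IHu IHv opprD addrACA.
- by rewrite !tensA_mul_pureE /kactr /kactl -!mulrA; exact: pureZ.
- by rewrite !tensA_mul_pureB IHu IHv.
Qed.

Fact tensA_mul_pureAl a b u : tensA_mul (pureA a b) u = tensA_mul_pure a b u.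
Proof.
have [fDl fDr fZ] := tensA_mul_balanced u; exact: (tens_liftE fDl fDr fZ).
Qed.

Fact tensA_mulE a b a' b' :
  tensA_mul (pureA a b) (pureA a' b') = pureA (a * a') (b * b').
Proof. by rewrite tensA_mul_pureAl tensA_mul_pureE. Qed.

Fact tensA_mulBl v : {morph tensA_mul^~ v : t u / t - u}.
Proof.
have [fDl fDr fZ] := tensA_mul_balanced v; exact: (tens_liftB fDl fDr fZ).
Qed.

Fact tensA_mulBr t : {morph tensA_mul t : u v / u - v}.
Proof.
move=> u v; elim/tens_ind: t => [a b|t t' IHt IHt'].
  by rewrite !tensA_mul_pureAl tensA_mul_pureB.
by rewrite !tensA_mulBl IHt IHt' [in LHS]opprD [in RHS]opprD addrACA.
Qed.

Fact tensA_mulA : associative tensA_mul.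
Proof.
move=> t u v; elim/tens_ind: t => [a b|? ? IH IH']; last first.
  by rewrite !tensA_mulBl IH IH'.
elim/tens_ind: u => [a' b'|? ? IH IH']; last first.
  by rewrite tensA_mulBr !tensA_mulBl tensA_mulBr IH IH'.
elim/tens_ind: v => [a'' b''|? ? IH IH']; last by rewrite !tensA_mulBr IH IH'.
by rewrite !tensA_mulE !mulrA.
Qed.

Fact tensA_mul1l : left_id (pureA 1 1) tensA_mul.
Proof.
move=> t; elim/tens_ind: t => [a b|? ? IH IH']; last by rewrite tensA_mulBr IH IH'.
by rewrite tensA_mulE !mul1r.
Qed.

Fact tensA_mul1r : right_id (pureA 1 1) tensA_mul.
Proof.
move=> t; elim/tens_ind: t => [a b|? ? IH IH']; last by rewrite tensA_mulBl IH IH'.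
by rewrite tensA_mulE !mulr1.
Qed.

Fact tensA_mulDl : left_distributive tensA_mul +%R.
Proof. by move=> t u v; apply: (morphB_morphD (tensA_mulBl v)). Qed.

Fact tensA_mulDr : right_distributive tensA_mul +%R.
Proof. by move=> t; apply: (morphB_morphD (tensA_mulBr t)). Qed.

HB.instance Definition _ := GRing.Zmodule_isPzRing.Build tensA
  tensA_mulA tensA_mul1l tensA_mul1r tensA_mulDl tensA_mulDr.

Lemma pureA_mul a b a' b' : pureA a b * pureA a' b' = pureA (a * a') (b * b').
Proof. exact: tensA_mulE. Qed.

Definition tensA_scal (c : k) : tensA := pureA (kscal c) 1.

Fact tensA_scal1 : tensA_scal 1 = 1.
Proof. by rewrite /tensA_scal kscal1. Qed.

Fact tensA_scalB : {morph tensA_scal : c d / c - d}.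
Proof.
move=> c d; apply/eqP; rewrite eq_sym subr_eq; apply/eqP.
by rewrite /tensA_scal /pureA -pureDl kscalB subrK.
Qed.

Fact tensA_scalM : {morph tensA_scal : c d / c * d}.
Proof. by move=> c d; rewrite /tensA_scal pureA_mul kscalM mulr1. Qed.

Fact tensA_scalC c t : tensA_scal c * t = t * tensA_scal c.
Proof.
elim/tens_ind: t => [a b|? ? IH IH']; last by rewrite mulrBr mulrBl IH IH'.
by rewrite !pureA_mul mulr1 mul1r kscalC.
Qed.

HB.instance Definition _ := isKAlgebra.Build k tensA
  tensA_scal1 tensA_scalB tensA_scalM tensA_scalC.

End TensorAlgebra.

Notation "A ⊗ B" := (tensA A B) (at level 40, left associativity) : type_scope.

(* The quotient of a k-algebra F by the two-sided ideal generated by the      *)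
(* differences x - y with rel x y.                                            *)
Section AlgebraQuotient.
Variables (k : pzRingType) (F : kalgType k) (rel : F -> F -> Prop).

(* The subgroup generated by these elements is a two-sided ideal. *)
Inductive ideal_gen : F -> Prop :=
| IdealGen a x y b of rel x y : ideal_gen (a * (x - y) * b).

Definition aquot : Type := zquot ideal_gen.
HB.instance Definition _ := GRing.Zmodule.on aquot.

Definition api (x : F) : aquot := zpi ideal_gen x.
HB.instance Definition _ :=
  GRing.isZmodMorphism.Build F aquot api (zpiB ideal_gen).

Definition arepr (t : aquot) : F := zrepr t.

Fact areprK : cancel arepr api.
Proof. exact: zreprK. Qed.

Lemma api_rel x y : rel x y -> api x = api y.
Proof.
move=> r; apply/zpi_eq; rewrite -[x - y]mul1r -[1 * _]mulr1.
exact/subgroup_gen/IdealGen.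
Qed.

Definition aquot_mul (t u : aquot) : aquot := api (arepr t * arepr u).

Fact ideal_mull a x : subgroup ideal_gen x -> subgroup ideal_gen (a * x).
Proof.
elim=> [_ [b y z c r]||y z _ IHy _ IHz]; last by rewrite mulrBr; exact: subgroupB.
  by rewrite !mulrA; exact/subgroup_gen/IdealGen.
by rewrite mulr0; exact: subgroup0.
Qed.

Fact ideal_mulr a x : subgroup ideal_gen x -> subgroup ideal_gen (x * a).
Proof.
elim=> [_ [b y z c r]||y z _ IHy _ IHz]; last by rewrite mulrBl; exact: subgroupB.
  by rewrite -mulrA; exact/subgroup_gen/IdealGen.
by rewrite mul0r; exact: subgroup0.
Qed.

Fact api_mul x y : aquot_mul (api x) (api y) = api (x * y).
Proof.
have Hr z : subgroup ideal_gen (arepr (api z) - z) by apply/zpi_eq/areprK.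
apply: etrans (_ : api (x * arepr (api y)) = _); apply/zpi_eq.
  by rewrite -mulrBl; exact/ideal_mulr.
by rewrite -mulrBr; exact/ideal_mull.
Qed.

Fact aquot_mulA : associative aquot_mul.
Proof.
by move=> t u v; rewrite -[t]areprK -[u]areprK -[v]areprK !api_mul mulrA.
Qed.

Fact aquot_mul1l : left_id (api 1) aquot_mul.
Proof. by move=> t; rewrite -[t]areprK api_mul mul1r. Qed.

Fact aquot_mul1r : right_id (api 1) aquot_mul.
Proof. by move=> t; rewrite -[t]areprK api_mul mulr1. Qed.

Fact aquot_mulDl : left_distributive aquot_mul +%R.
Proof.
move=> t u v; rewrite -[t]areprK -[u]areprK -[v]areprK.
by rewrite -raddfD !api_mul mulrDl raddfD.
Qed.

Fact aquot_mulDr : right_distributive aquot_mul +%R.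
Proof.
move=> t u v; rewrite -[t]areprK -[u]areprK -[v]areprK.
by rewrite -raddfD !api_mul mulrDr raddfD.
Qed.

HB.instance Definition _ := GRing.Zmodule_isPzRing.Build aquot
  aquot_mulA aquot_mul1l aquot_mul1r aquot_mulDl aquot_mulDr.

Fact api_monoid_morphism : monoid_morphism api.
Proof. by split=> [|x y]; last rewrite -api_mul. Qed.

HB.instance Definition _ :=
  GRing.isMonoidMorphism.Build F aquot api api_monoid_morphism.

Definition aquot_scal (c : k) : aquot := api (kscal c).

Fact aquot_scal1 : aquot_scal 1 = 1.
Proof. by rewrite /aquot_scal kscal1 rmorph1. Qed.

Fact aquot_scalB : {morph aquot_scal : c d / c - d}.
Proof. by move=> c d; rewrite /aquot_scal kscalB raddfB. Qed.

Fact aquot_scalM : {morph aquot_scal : c d / c * d}.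
Proof. by move=> c d; rewrite /aquot_scal kscalM rmorphM. Qed.

Fact aquot_scalC c t : aquot_scal c * t = t * aquot_scal c.
Proof. by rewrite -[t]areprK -!rmorphM kscalC. Qed.

HB.instance Definition _ := isKAlgebra.Build k aquot
  aquot_scal1 aquot_scalB aquot_scalM aquot_scalC.

End AlgebraQuotient.

#[global] Opaque aquot api arepr aquot_mul.

(* The free unital k-algebra on the generators I. *)
Section FreeAlgebra.
Variables (k : fieldType) (I : choiceType).

Definition freeA : Type := {malg k[{fmonom I}]}.
HB.instance Definition _ := GRing.NzRing.on freeA.

Definition gen (i : I) : freeA := << fmu i >>.

Definition freeA_scal (c : k) : freeA := malgC c.

Fact freeA_scal1 : freeA_scal 1 = 1. Proof. by []. Qed.

Fact freeA_scalB : {morph freeA_scal : c d / c - d}.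
Proof. exact: monalgUB. Qed.

Fact freeA_scalM : {morph freeA_scal : c d / c * d}.
Proof. exact: mpolyCM. Qed.

Fact freeA_scalC c x : freeA_scal c * x = x * freeA_scal c.
Proof.
rewrite [x]monalgE mulr_suml mulr_sumr; apply: eq_bigr => m _.
apply: etrans (fgmulUU _ _ _ _) _; apply: etrans _ (esym (fgmulUU _ _ _ _)).
by rewrite mulrC mul1m mulm1.
Qed.

HB.instance Definition _ := isKAlgebra.Build k freeA
  freeA_scal1 freeA_scalB freeA_scalM freeA_scalC.

End FreeAlgebra.

(* inl i and inr i index x_(i+1) and x_(i+1)^*. *)
Inductive Linf_rel (k : fieldType) :
    freeA k (nat + nat)%type -> freeA k (nat + nat)%type -> Prop :=
| LinfRel i j : Linf_rel (gen k (inr i) * gen k (inl j)) (i == j)%:R.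

Definition Linf (k : fieldType) : Type := aquot (@Linf_rel k).
HB.instance Definition _ (k : fieldType) := KAlgebra.on (Linf k).

Record quiver := Quiver {
  vertex : finType;
  arrow : finType;
  src : arrow -> vertex;
  rng : arrow -> vertex
}.

Definition sink (E : quiver) (i : vertex E) : bool := [forall a, src a != i].

Definition has_closed_path (E : quiver) : Prop :=
  exists (a : arrow E) (p : seq (arrow E)),
    path (fun x y => rng x == src y) a p /\ rng (last a p) = src a.

(* inl a is the arrow a itself and inr a is its opposite a^*. *)
Definition hat (E : quiver) : quiver :=
  @Quiver (vertex E) (arrow E + arrow E)%type
    (fun a => match a with inl a => src a | inr a => rng a end)
    (fun a => match a with inl a => rng a | inr a => src a end).

Section Leavitt.
Variables (k : fieldType) (E : quiver).

Local Notation F := (freeA k (vertex E + arrow (hat E))%type).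

Let p (i : vertex E) : F := gen k (inl i).
Let ar (a : arrow (hat E)) : F := gen k (inr a).

(* freeA is unital, hence the relation leavitt_unit, which makes the sum of   *)
(* the vertices the unit.                                                     *)
Inductive leavitt_rel : F -> F -> Prop :=
| leavitt_vertex i j : leavitt_rel (p i * p j) (p i *+ (i == j))
| leavitt_src (a : arrow (hat E)) : leavitt_rel (p (src a) * ar a) (ar a)
| leavitt_rng (a : arrow (hat E)) : leavitt_rel (ar a * p (rng a)) (ar a)
| leavitt_CK1 (a b : arrow E) :
    leavitt_rel (ar (inr a) * ar (inl b)) (p (rng a) *+ (a == b))
| leavitt_CK2 (i : vertex E) of ~~ sink i :
    leavitt_rel (p i) (\sum_(a | src a == i) ar (inl a) * ar (inr a))
| leavitt_unit : leavitt_rel 1 (\sum_i p i).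

Definition leavitt : Type := aquot leavitt_rel.
HB.instance Definition _ := KAlgebra.on leavitt.

End Leavitt.

(* An R (x) S^op-module P and an S (x) R^op-module Q are an (R, S)-bimodule   *)
(* and an (S, R)-bimodule on which k acts centrally.                          *)
Section Morita.
Variable k : comPzRingType.

Section Bimodules.
Variables (R S : kalgType k).
Variables (P : lmodType (R ⊗ S^c)) (Q : lmodType (S ⊗ R^c)).

Definition bimod_tens : Type :=
  tens (fun (p : P) (s : S) => pureA (1 : R) (s : S^c) *: p)
       (fun (s : S) (q : Q) => pureA s (1 : R^c) *: q).
HB.instance Definition _ := GRing.Zmodule.on bimod_tens.

(* P (x)_S Q is isomorphic to R as an (R, R)-bimodule; pure tensors generate, *)
(* so linearity is only required on them.                                     *)
Definition bimod_tens_iso : Prop :=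
  exists f : {additive bimod_tens -> R}, bijective f /\
    forall (r r' : R) (p : P) (q : Q),
      f (pure _ _ (pureA r (1 : S^c) *: p) (pureA (1 : S) (r' : R^c) *: q))
      = r * f (pure _ _ p q) * r'.

End Bimodules.

Definition morita_equivalent (R S : kalgType k) : Prop :=
  exists (P : lmodType (R ⊗ S^c)) (Q : lmodType (S ⊗ R^c)),
    bimod_tens_iso P Q /\ bimod_tens_iso Q P.

End Morita.

(* Main.v *)
Require Import Defs.
From mathcomp Require Import all_boot all_order all_algebra.
From HB Require Import structures.
From mathcomp Require Import boolp finmap.
From mathcomp.multinomials Require Import monalg.
From Stdlib Require Ncring Ncring_tac.

(** The algebras L(E) and L_oo have Hochschild dimension at most one, whereas a
    tensor product of two algebras each carrying a nonzero class in HH_1 has a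
    nonzero class in HH_2.  Morita equivalence preserves Hochschild homology, so
    the two cannot be equivalent.  The proof is this argument, reduced to what is
    needed in degree two.

    Dimension at most one is used as Cuntz-Quillen quasi-freeness: every
    extension with square-zero kernel splits ([leavitt_quasi_free],
    [Linf_quasi_free]).  The generators are lifted arbitrarily and corrected by
    explicit formulas, which are exact because the errors multiply to zero
    ([lift_orthogonal_idempotents], [lift_CK_family], [lift_dual_families]).
    Applied to the extension of S defined by a Hochschild 2-cocycle, a splitting
    exhibits the cocycle as a coboundary ([quasi_free_coboundary]).

    The class in HH_1 is recorded by [eigen_trace]: a derivation d, a trace t and
    an element x with d x = x and t x = 1.  For L(E), x is a closed path meeting
    its first arrow a only once and d counts the occurrences of a.  The trace
    counts, on words of degree the length of x, the infinite paths that the word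
    fixes; in a nonzero degree a word fixes at most one infinite path
    ([fixes_unique]), so the relation that splits a vertex into the arrows leaving
    it is respected.  For L_oo, x is the first generator.

    Let R be the tensor product of two such algebras, with the derivations d1, d2
    acting on one factor each, the product trace t, and the commuting elements
    x (x) 1 and 1 (x) y.  The cyclic 2-cocycle t(r0 d1(r1) d2(r2)) takes the value
    t(xy) = 1 on the cycle (1, x, y) - (1, y, x).  An equivalence of R with S is
    turned into an invertible bimodule with compatible pairings
    ([morita_invertible_bimodule]); through it the cocycle is moved to S, where it
    is a coboundary, and the cycle is moved to a cycle, so the value of one on the
    other is zero ([transported_symmetric]).  A direct computation shows that this
    value is still t(xy) ([induced_cocycle_comm]), a contradiction. *)

Set Implicit Arguments.
Unset Strict Implicit.
Unset Printing Implicit Defensive.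

Import GRing.Theory.
Local Open Scope ring_scope.

(** * Noncommutative rings, derivations and traces *)

(** These instances make a decision procedure for identities in noncommutative
    rings available as [ncring]. *)
Section NoncommutativeRingTactic.
Variable R : pzRingType.

#[global] Instance pzRing_ops :
  @Ncring.Ring_ops R 0 1 +%R *%R (fun x y => x - y) -%R eq := {}.

#[global] Instance pzRing_ring : Ncring.Ring (Ro := pzRing_ops).
Proof.
constructor.
- exact: RelationClasses.eq_equivalence.
- by move=> x y -> z t ->.
- by move=> x y -> z t ->.
- by move=> x y -> z t ->.
- by move=> x y ->.
- exact: (@add0r R).
- exact: (@addrC R).
- exact: (@addrA R).
- exact: (@mul1r R).
- exact: (@mulr1 R).
- exact: (@mulrA R).
- exact: (@mulrDl R).
- by move=> x y z; exact: (@mulrDr R).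
- by [].
- exact: (@subrr R).
Qed.

End NoncommutativeRingTactic.

Ltac ncring := Ncring_tac.non_commutative_ring.

Definition is_derivation (A : pzRingType) (d : A -> A) : Prop :=
  forall a b, d (a * b) = d a * b + a * d b.

Definition is_trace (A : pzRingType) (V : zmodType) (t : A -> V) : Prop :=
  forall a b, t (a * b) = t (b * a).

(** A dual basis u, v, with sum of u i * v i equal to 1, replaces (r0, r1, r2) by
    matrices (v i * r * u j), as happens when a chain is moved to a Morita
    equivalent ring and back.  The value of t(r0 d1(r1) d2(r2)) on the cycle
    (1, x, y) - (1, y, x) survives this. *)
Section CyclicCocycle.
Variables (R : pzRingType) (V : zmodType) (t : {additive R -> V}).
Variables (d1 d2 : {additive R -> R}).
Hypotheses (tC : is_trace t) (d1M : is_derivation d1) (d2M : is_derivation d2).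
Variables (I : finType) (v u : I -> R).
Hypothesis uv1 : \sum_i u i * v i = 1.

Let al := \sum_i u i * d1 (v i).
Let be := \sum_i u i * d2 (v i).
Let ga := \sum_i d1 (u i) * d2 (v i).

Lemma derivation1 (d : {additive R -> R}) : is_derivation d -> d 1 = 0.
Proof.
by move=> dM; apply: (addrI (d 1)); rewrite addr0 -{3}[1]mulr1 dM mulr1 mul1r.
Qed.

(** This is d applied to the relation that the u i * v i sum to 1. *)
Lemma derivation_dual_basis (d : {additive R -> R}) : is_derivation d ->
  \sum_i d (u i) * v i = - \sum_i u i * d (v i).
Proof.
move=> dM; apply/eqP; rewrite -subr_eq0 opprK -big_split /=.
under eq_bigr do rewrite -dM.
by rewrite -raddf_sum uv1 derivation1.
Qed.

Definition induced_cocycle x y :=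
  \sum_i \sum_j \sum_l
    t (v i * u j * d1 (v j * x * u l) * d2 (v l * y * u i)).

(** The three sums over the dual basis collapse to al, be, ga, the sums of
    u * d1 v, u * d2 v and d1 u * d2 v. *)
Lemma induced_cocycleE x y : induced_cocycle x y =
  t ((al * x + d1 x) * (be * y + d2 y - y * be)
     + x * (ga * y - al * (d2 y - y * be))).
Proof.
have E1 l : \sum_j u j * d1 (v j * x * u l) = (al * x + d1 x) * u l + x * d1 (u l).
  have -> : (al * x + d1 x) * u l + x * d1 (u l)
      = al * x * u l + (\sum_i u i * v i) * (d1 x * u l + x * d1 (u l)).
    by rewrite uv1; ncring.
  rewrite /al !mulr_suml -big_split /=; apply: eq_bigr => j _.
  by rewrite !d1M; ncring.
have E2 l : \sum_i d2 (v l * y * u i) * v i = d2 (v l) * y + v l * (d2 y - y * be).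
  have -> : d2 (v l) * y + v l * (d2 y - y * be)
      = (d2 (v l) * y + v l * d2 y) * (\sum_i u i * v i)
        + v l * y * (\sum_i d2 (u i) * v i).
    by rewrite uv1 derivation_dual_basis // -/be; ncring.
  rewrite !mulr_sumr -big_split /=; apply: eq_bigr => j _.
  by rewrite !d2M; ncring.
transitivity (t (\sum_l (\sum_j u j * d1 (v j * x * u l))
                 * (\sum_i d2 (v l * y * u i) * v i))).
  rewrite raddf_sum /= /induced_cocycle exchange_big /=.
  rewrite [LHS](_ : _ = \sum_l \sum_j \sum_i
      t (v i * u j * d1 (v j * x * u l) * d2 (v l * y * u i))); last first.
    rewrite [RHS]exchange_big /=; apply: eq_bigr => j _.
    by rewrite exchange_big.
  apply: eq_bigr => l _; rewrite mulr_suml raddf_sum; apply: eq_bigr => j _.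
  rewrite mulr_sumr raddf_sum; apply: eq_bigr => i _ /=.
  by rewrite -!mulrA [LHS]tC -!mulrA.
have E3 a w : \sum_l (a * u l + x * d1 (u l)) * (d2 (v l) * y + v l * w)
    = a * (be * y + w) + x * (ga * y - al * w).
  transitivity (a * (be * y + (\sum_l u l * v l) * w)
                + x * (ga * y + (\sum_l d1 (u l) * v l) * w)).
    rewrite /be /ga !mulr_suml -!big_split /= !mulr_sumr -!big_split /=.
    by apply: eq_bigr => l _; ncring.
  by rewrite uv1 derivation_dual_basis // -/al; ncring.
under eq_bigr do rewrite E1 E2.
by rewrite E3 addrA.
Qed.

(** Antisymmetrising the closed formula in x and y leaves t(xy), all other terms
    being commutators or multiples of xy - yx. *)
Lemma induced_cocycle_comm x y : x * y = y * x ->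
  d1 x = x -> d2 y = y -> d1 y = 0 -> d2 x = 0 ->
  induced_cocycle x y = induced_cocycle y x + t (x * y).
Proof.
move=> xyC d1x d2y d1y d2x; rewrite !induced_cocycleE d1x d2y d1y d2x.
have tK a b : t (a * b - b * a) = 0 by rewrite raddfB tC subrr.
have c0 : x * y - y * x = 0 by rewrite xyC subrr.
apply/eqP; rewrite -raddfD -subr_eq0 -raddfB /=.
move: al be ga => al' be' ga'.
rewrite [X in t X](_ : _ =
   (al' * x * be' * y - y * (al' * x * be')) - al' * (x * y - y * x) * be'
   + (x * (al' * y * be') - al' * y * be' * x)
   + (x * (ga' * y) - ga' * y * x) - (y * (ga' * x) - ga' * x * y)
   - ga' * (x * y - y * x) - (x * (al' * y) - al' * y * x) + al' * (x * y - y * x)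
   + (x * be' * y - y * (x * be')) - (x * y - y * x) * be'); last by ncring.
have tsum a b c d e f : t a = 0 -> t b = 0 -> t c = 0 -> t d = 0 -> t e = 0 ->
    t f = 0 -> t (a + b + c - d - e + f) = 0.
  by rewrite !(raddfD, raddfN) /= => -> -> -> -> -> ->; rewrite !(addr0, subr0).
rewrite c0 !(mulr0, mul0r) !(subr0, addr0); apply/eqP/tsum; exact: tK.
Qed.

End CyclicCocycle.

Section AdditiveOfMorph.
Variables (V W : zmodType) (f : V -> W) (fB : {morph f : x y / x - y}).
Definition additive_of : {additive V -> W} :=
  HB.pack_for {additive V -> W} f (GRing.isZmodMorphism.Build _ _ _ fB).
End AdditiveOfMorph.

(** * Square-zero extensions *)

Definition klinear_hom (k : pzRingType) (A B : kalgType k) (f : A -> B) : Prop :=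
  forall c, f (kscal c) = kscal c.

Definition quasi_free (k : pzRingType) (S : kalgType k) : Prop :=
  forall (T : kalgType k) (f : {rmorphism T -> S}),
    klinear_hom f -> (forall s, exists u, f u = s) ->
    (forall x y, f x = 0 -> f y = 0 -> x * y = 0) ->
  exists g : {rmorphism S -> T}, klinear_hom g /\ cancel g f.

Section CocycleExtension.
Variables (k : pzRingType) (S : kalgType k).

(** Hochschild 2-cocycles with values in S itself: these coefficients
    suffice, as a Morita equivalence takes the bimodule R over R to
    the bimodule S over S. *)
Record cocycle := Cocycle {
  cocycle_fun :> S -> S -> S;
  cocycleDl : forall a b c, cocycle_fun (a + b) c = cocycle_fun a c + cocycle_fun b c;
  cocycleDr : forall a b c, cocycle_fun a (b + c) = cocycle_fun a b + cocycle_fun a c;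
  cocycleZl : forall l a b, cocycle_fun (kscal l * a) b = kscal l * cocycle_fun a b;
  cocycleZr : forall l a b, cocycle_fun a (kscal l * b) = kscal l * cocycle_fun a b;
  cocycleP : forall a b c, a * cocycle_fun b c + cocycle_fun a (b * c)
    = cocycle_fun (a * b) c + cocycle_fun a b * c
}.

Definition cocycle_ext (c : cocycle) : Type := (S * S)%type.
HB.instance Definition _ (c : cocycle) := GRing.Zmodule.on (cocycle_ext c).

Variable c : cocycle.

(** Cocycles are not assumed normalised; the unit of the extension absorbs c 1 1. *)
Lemma cocycle1l a : c 1 a = c 1 1 * a.
Proof.
by have := cocycleP c 1 1 a; rewrite !mul1r => /addrI.
Qed.

Lemma cocycle1r a : c a 1 = a * c 1 1.
Proof.
by have := cocycleP c a 1 1; rewrite !mulr1 [RHS]addrC => /addIr.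
Qed.

Local Notation ext := (cocycle_ext c).

Definition ext_mul (x y : ext) : ext :=
  (x.1 * y.1, x.1 * y.2 + x.2 * y.1 + c x.1 y.1).

Definition ext_one : ext := (1, - c 1 1).

Fact ext_mulA : associative ext_mul.
Proof.
move=> [a a'] [b b'] [d d']; rewrite /ext_mul /=; congr pair; first exact: mulrA.
have := cocycleP c a b d.
move: (c b d) (c a (b * d)) (c (a * b) d) (c a b) => p q r s /eqP.
rewrite -subr_eq0 => /eqP E; apply/eqP; rewrite -subr_eq0 -E.
by apply/eqP; ncring.
Qed.

Fact ext_mul1l : left_id ext_one ext_mul.
Proof.
move=> [a a']; rewrite /ext_mul /ext_one /= (cocycle1l a); congr pair; first exact: mul1r.
by ncring.
Qed.

Fact ext_mul1r : right_id ext_one ext_mul.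
Proof.
move=> [a a']; rewrite /ext_mul /ext_one /= (cocycle1r a); congr pair; first exact: mulr1.
by ncring.
Qed.

Fact ext_mulDl : left_distributive ext_mul +%R.
Proof.
move=> [a a'] [b b'] [d d']; rewrite /ext_mul /= cocycleDl.
by congr pair => /=; ncring.
Qed.

Fact ext_mulDr : right_distributive ext_mul +%R.
Proof.
move=> [a a'] [b b'] [d d']; rewrite /ext_mul /= cocycleDr.
by congr pair => /=; ncring.
Qed.

HB.instance Definition _ := GRing.Zmodule_isPzRing.Build ext
  ext_mulA ext_mul1l ext_mul1r ext_mulDl ext_mulDr.

Definition ext_scal (l : k) : ext := (kscal l, - kscal l * c 1 1).

Lemma ext_scal_mull l (x : ext) : ext_scal l * x = (kscal l * x.1, kscal l * x.2).
Proof.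
case: x => a a'; congr pair => //=.
have -> : c (kscal l) a = kscal l * (c 1 1 * a).
  by rewrite -cocycle1l -cocycleZl mulr1.
by ncring.
Qed.

Lemma ext_scal_mulr l (x : ext) : x * ext_scal l = (kscal l * x.1, kscal l * x.2).
Proof.
case: x => a a'; congr pair => /=; first by rewrite kscalC.
have -> : c a (kscal l) = kscal l * (a * c 1 1).
  by rewrite -cocycle1r -cocycleZr mulr1.
by rewrite -(kscalC _ a') !mulNr !mulrN !mulrA -(kscalC _ a); ncring.
Qed.

Fact ext_scal1 : ext_scal 1 = 1.
Proof. by rewrite /ext_scal kscal1 mulN1r. Qed.

Fact ext_scalB : {morph ext_scal : l m / l - m}.
Proof. by move=> l m; congr pair => /=; rewrite kscalB //; ncring. Qed.

Fact ext_scalM : {morph ext_scal : l m / l * m}.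
Proof.
by move=> l m; rewrite ext_scal_mull /ext_scal kscalM /= mulrA mulrN mulNr.
Qed.

Fact ext_scalC l (x : ext) : ext_scal l * x = x * ext_scal l.
Proof. by rewrite ext_scal_mull ext_scal_mulr. Qed.

HB.instance Definition _ := isKAlgebra.Build k ext
  ext_scal1 ext_scalB ext_scalM ext_scalC.

Definition ext_proj (x : ext) : S := x.1.

Fact ext_projB : {morph ext_proj : x y / x - y}. Proof. by []. Qed.
Fact ext_projM : monoid_morphism ext_proj. Proof. by []. Qed.

HB.instance Definition _ := GRing.isZmodMorphism.Build ext S ext_proj ext_projB.
HB.instance Definition _ := GRing.isMonoidMorphism.Build ext S ext_proj ext_projM.

Lemma cocycle0l a : c 0 a = 0.
Proof. by apply: (addrI (c 0 a)); rewrite -cocycleDl !addr0. Qed.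

(** The second component of a multiplicative section is a primitive of c. *)
Lemma section_coboundary (g : {rmorphism S -> ext}) : cancel g ext_proj ->
  exists d : {additive S -> S}, (forall a, g a = (a, d a)) /\
    forall a b, d (a * b) = a * d b + d a * b + c a b.
Proof.
move=> gK; have gE a : (g a).1 = a by exact: gK.
have dB : {morph (fun a => (g a).2) : a b / a - b}.
  by move=> a b; rewrite raddfB.
exists (additive_of dB); split=> [a|a b] /=; first by rewrite -{2}[a]gE; case: (g a).
by rewrite rmorphM /= !gE.
Qed.

Lemma quasi_free_coboundary : quasi_free S ->
  exists d : {additive S -> S}, forall a b, d (a * b) = a * d b + d a * b + c a b.
Proof.
case/(_ ext ext_proj) => // [s|x y|g [_ /section_coboundary[d [_ dM]]]].
- by exists (s, 0).
- rewrite /ext_proj; case: x y => [x1 x2] [y1 y2] /= -> ->; congr pair => /=.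
    by rewrite mulr0.
  by rewrite mul0r mulr0 cocycle0l !addr0.
by exists d.
Qed.

End CocycleExtension.

Section ZeroCocycle.
Variables (k : pzRingType) (S : kalgType k).

(** The extension by the zero cocycle is the algebra of dual numbers, whose
    sections are the derivations. *)
Definition zero_cocycle : cocycle S.
Proof.
by refine (@Cocycle k S (fun _ _ => 0) _ _ _ _ _) => *;
  rewrite ?(mulr0, mul0r, addr0).
Defined.

Lemma section_derivation (g : {rmorphism S -> cocycle_ext zero_cocycle}) :
  klinear_hom g -> cancel g (@ext_proj k S zero_cocycle) ->
  exists d : {additive S -> S},
    [/\ is_derivation d, forall l, d (kscal l) = 0 & forall a, (g a).2 = d a].
Proof.
move=> gk /section_coboundary[d [gE dM]]; exists d; split=> [a b|l|a].
- by rewrite dM addr0 addrC.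
- by have := gk l; rewrite gE => -[->]; rewrite mulr0.
- by rewrite gE.
Qed.

End ZeroCocycle.

(** * Morita equivalences as invertible bimodules *)

(** A bimodule Q with a type P of functionals on it, valued in R through [pq] and
    in S through [qp], for which Q is finitely generated projective on either side.
    [qp_pq] is the compatibility of the two pairings, which the two isomorphisms of
    a Morita equivalence satisfy only after one of them is modified. *)
Record invertible_bimodule (k : comPzRingType) (R S : kalgType k) := InvBimodule {
  ibQ : zmodType;
  ibP : Type;
  ibl : S -> ibQ -> ibQ;
  ibr : ibQ -> R -> ibQ;
  pq : ibP -> ibQ -> R;
  qp : ibQ -> ibP -> S;
  iblDl : forall s t q, ibl (s + t) q = ibl s q + ibl t q;
  iblA : forall s t q, ibl s (ibl t q) = ibl (s * t) q;
  ibl1 : forall q, ibl 1 q = q;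
  ibrDr : forall q r r', ibr q (r + r') = ibr q r + ibr q r';
  ibrA : forall q r r', ibr (ibr q r) r' = ibr q (r * r');
  iblr : forall s q r, ibl s (ibr q r) = ibr (ibl s q) r;
  ibZ : forall l q, ibl (kscal l) q = ibr q (kscal l);
  pqD : forall p q q', pq p (q + q') = pq p q + pq p q';
  pqr : forall p q r, pq p (ibr q r) = pq p q * r;
  qpD : forall q q' p, qp (q + q') p = qp q p + qp q' p;
  qpl : forall s q p, qp (ibl s q) p = s * qp q p;
  qp_pq : forall q p q', ibl (qp q p) q' = ibr q (pq p q');
  pq_unit : exists n (p : 'I_n -> ibP) (q : 'I_n -> ibQ), \sum_i pq (p i) (q i) = 1;
  qp_unit : exists n (q : 'I_n -> ibQ) (p : 'I_n -> ibP), \sum_i qp (q i) (p i) = 1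
}.

Lemma tens_sum (P Q : zmodType) (S : Type) (ra : P -> S -> P) (la : S -> Q -> Q)
    (t : tens ra la) :
  exists n (p : 'I_n -> P) (q : 'I_n -> Q), t = \sum_i pure ra la (p i) (q i).
Proof.
suff [s ->] : exists s : seq (P * Q), t = \sum_(x <- s) pure ra la x.1 x.2.
  exists (size s), (fun i => (tnth (in_tuple s) i).1).
  exists (fun i => (tnth (in_tuple s) i).2).
  by rewrite (big_tnth _ _ s).
elim/tens_ind: t => [p q|_ _ [s ->] [s' ->]].
  by exists [:: (p, q)]; rewrite big_seq1.
have pureN p q : pure ra la (- p) q = - pure ra la p q.
  apply/eqP; rewrite -addr_eq0 -pureDl addNr; apply/eqP.
  by apply: (addrI (pure ra la 0 q)); rewrite -pureDl !addr0.
exists (s ++ [seq (- x.1, x.2) | x <- s']).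
rewrite big_cat big_map -sumrN; congr (_ + _).
by apply: eq_bigr => x _; rewrite pureN.
Qed.

(** The isomorphisms f : P (x) Q -> R and g : Q (x) P -> S need not be compatible:
    b f(a (x) d) and g(b (x) a) d may differ.  They differ by an automorphism
    [twist] of Q, and f(a (x) twist d) is compatible with g. *)
Section MoritaContext.
Variables (k : comPzRingType) (R S : kalgType k).
Variables (P : lmodType (R ⊗ S^c)%type) (Q : lmodType (S ⊗ R^c)%type).

Let lP (r : R) (p : P) : P := pureA r (1 : S^c) *: p.
Let rP (p : P) (s : S) : P := pureA (1 : R) (s : S^c) *: p.
Let lQ (s : S) (q : Q) : Q := pureA s (1 : R^c) *: q.
Let rQ (q : Q) (r : R) : Q := pureA (1 : S) (r : R^c) *: q.
Local Notation PQ := (pure rP lQ).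
Local Notation QP := (pure rQ lP).

Lemma lactDl s t q : lQ (s + t) q = lQ s q + lQ t q.
Proof. by rewrite /lQ /pureA pureDl scalerDl. Qed.

Lemma lactDr s q q' : lQ s (q + q') = lQ s q + lQ s q'.
Proof. by rewrite /lQ scalerDr. Qed.

Lemma lactA s t q : lQ s (lQ t q) = lQ (s * t) q.
Proof. by rewrite /lQ scalerA pureA_mul mulr1. Qed.

Lemma ractDl q q' r : rQ (q + q') r = rQ q r + rQ q' r.
Proof. by rewrite /rQ scalerDr. Qed.

Lemma ractDr q r r' : rQ q (r + r') = rQ q r + rQ q r'.
Proof. by rewrite /rQ /pureA pureDr scalerDl. Qed.

Lemma ractA q r r' : rQ (rQ q r) r' = rQ q (r * r').
Proof. by rewrite /rQ scalerA pureA_mul mulr1. Qed.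

Lemma lract_comm s q r : rQ (lQ s q) r = lQ s (rQ q r).
Proof. by rewrite /rQ /lQ !scalerA !pureA_mul !mulr1 !mul1r. Qed.

Lemma lact1 q : lQ 1 q = q.
Proof. exact: scale1r. Qed.

Lemma ract1 q : rQ q 1 = q.
Proof. exact: scale1r. Qed.

Lemma act_scal l q : lQ (kscal l) q = rQ q (kscal l).
Proof.
rewrite /lQ /rQ; congr (_ *: _).
rewrite -[kscal l in LHS]mulr1 -[kscal l in RHS](@mulr1 R^c).
exact: pureZ.
Qed.

Lemma lact1_P p : lP 1 p = p.
Proof. exact: scale1r. Qed.

Lemma ract1_P p : rP p 1 = p.
Proof. exact: scale1r. Qed.

Variables (f : {additive bimod_tens P Q -> R}) (g : {additive bimod_tens Q P -> S}).
Variables (f' : R -> bimod_tens P Q) (g' : S -> bimod_tens Q P).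
Hypotheses (fK : cancel f f') (f'K : cancel f' f).
Hypotheses (gK : cancel g g') (g'K : cancel g' g).
Hypothesis fM : forall (r r' : R) p q, f (PQ (lP r p) (rQ q r')) = r * f (PQ p q) * r'.
Hypothesis gM : forall (s s' : S) q p, g (QP (lQ s q) (rP p s')) = s * g (QP q p) * s'.

Lemma PQ_iso_l r p q : f (PQ (lP r p) q) = r * f (PQ p q).
Proof. by rewrite -{1}[q]ract1 fM mulr1. Qed.

Lemma PQ_iso_r r p q : f (PQ p (rQ q r)) = f (PQ p q) * r.
Proof. by rewrite -{1}[p]lact1_P fM mul1r. Qed.

Lemma QP_iso_l s q p : g (QP (lQ s q) p) = s * g (QP q p).
Proof. by rewrite -{1}[p]ract1_P gM mulr1. Qed.

Lemma QP_iso_r s q p : g (QP q (rP p s)) = g (QP q p) * s.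
Proof. by rewrite -{1}[q]lact1 gM mul1r. Qed.

Variables (n : nat) (a : 'I_n -> P) (b : 'I_n -> Q).
Hypothesis f1 : f' 1 = \sum_i PQ (a i) (b i).
Variables (m : nat) (c : 'I_m -> Q) (d : 'I_m -> P).
Hypothesis g1 : g' 1 = \sum_i QP (c i) (d i).

Lemma PQ_inv_l r : f' r = \sum_i PQ (lP r (a i)) (b i).
Proof.
apply: (can_inj fK); rewrite f'K raddf_sum; under eq_bigr do rewrite PQ_iso_l.
by rewrite -mulr_sumr -raddf_sum -f1 f'K mulr1.
Qed.

Lemma PQ_inv_r r : f' r = \sum_i PQ (a i) (rQ (b i) r).
Proof.
apply: (can_inj fK); rewrite f'K raddf_sum; under eq_bigr do rewrite PQ_iso_r.
by rewrite -mulr_suml -raddf_sum -f1 f'K mul1r.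
Qed.

Lemma QP_inv_l s : g' s = \sum_i QP (lQ s (c i)) (d i).
Proof.
apply: (can_inj gK); rewrite g'K raddf_sum; under eq_bigr do rewrite QP_iso_l.
by rewrite -mulr_sumr -raddf_sum -g1 g'K mulr1.
Qed.

Lemma QP_inv_r s : g' s = \sum_i QP (c i) (rP (d i) s).
Proof.
apply: (can_inj gK); rewrite g'K raddf_sum; under eq_bigr do rewrite QP_iso_r.
by rewrite -mulr_suml -raddf_sum -g1 g'K mul1r.
Qed.

(* For fixed q these send p (x) q' to g(q (x) p) q', and q' (x) p to
   q' f(p (x) q). *)
Let contractPQ q (t : bimod_tens P Q) : Q := tens_lift (fun p q' => lQ (g (QP q p)) q') t.
Let contractQP q (t : bimod_tens Q P) : Q := tens_lift (fun q' p => rQ q' (f (PQ p q))) t.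

Fact contractPQ_bal q (h := fun p q' => lQ (g (QP q p)) q') :
  [/\ forall p p' q', h (p + p') q' = h p q' + h p' q',
      forall p q' q'', h p (q' + q'') = h p q' + h p q'' &
      forall p s q', h (rP p s) q' = h p (lQ s q')].
Proof.
rewrite /h; split=> [p p' q'|p q' q''|p s q'].
- by rewrite pureDr raddfD lactDl.
- by rewrite lactDr.
- by rewrite QP_iso_r lactA.
Qed.

Fact contractQP_bal q (h := fun q' p => rQ q' (f (PQ p q))) :
  [/\ forall q' q'' p, h (q' + q'') p = h q' p + h q'' p,
      forall q' p p', h q' (p + p') = h q' p + h q' p' &
      forall q' r p, h (rQ q' r) p = h q' (lP r p)].
Proof.
rewrite /h; split=> [q' q'' p|q' p p'|q' r p].
- by rewrite ractDl.
- by rewrite pureDl raddfD ractDr.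
- by rewrite PQ_iso_l ractA.
Qed.

Lemma contractPQE q p q' : contractPQ q (PQ p q') = lQ (g (QP q p)) q'.
Proof. by case: (contractPQ_bal q) => H1 H2 H3; apply: (tens_liftE H1 H2 H3). Qed.

Lemma contractQPE q q' p : contractQP q (QP q' p) = rQ q' (f (PQ p q)).
Proof. by case: (contractQP_bal q) => H1 H2 H3; apply: (tens_liftE H1 H2 H3). Qed.

Lemma contractPQB q : {morph contractPQ q : t u / t - u}.
Proof. by case: (contractPQ_bal q) => H1 H2 H3; apply: (tens_liftB H1 H2 H3). Qed.

Lemma contractQPB q : {morph contractQP q : t u / t - u}.
Proof. by case: (contractQP_bal q) => H1 H2 H3; apply: (tens_liftB H1 H2 H3). Qed.

Lemma morphB_sum (V W : zmodType) (h : V -> W) (I : finType) (v : I -> V) :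
  {morph h : x y / x - y} -> h (\sum_i v i) = \sum_i h (v i).
Proof.
move=> hB; apply: (big_morph h); first exact: morphB_morphD.
by rewrite -(subrr 0) hB subrr.
Qed.

Let twist q : Q := \sum_i lQ (g (QP q (a i))) (b i).
Let untwist q : Q := \sum_j rQ (c j) (f (PQ (d j) q)).

(** The sum of the a i (x) b i is f^-1(1), and r f^-1(1) = f^-1(1) r since f is a
    bimodule map; hence [twist] of q r is q contracted with f^-1(r). *)
Lemma twist_contract q r : twist (rQ q r) = contractPQ q (f' r).
Proof.
rewrite PQ_inv_l (morphB_sum _ (contractPQB q)); apply: eq_bigr => i _.
by rewrite contractPQE (pureZ rQ lP).
Qed.

Lemma untwist_contract s q : untwist (lQ s q) = contractQP q (g' s).
Proof.
rewrite QP_inv_r (morphB_sum _ (contractQPB q)); apply: eq_bigr => i _.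
by rewrite contractQPE -(pureZ rP lQ).
Qed.

Lemma twist_ract q r : twist (rQ q r) = rQ (twist q) r.
Proof.
rewrite twist_contract PQ_inv_r (morphB_sum _ (contractPQB q)) /twist.
rewrite (morphB_sum (h := rQ^~ r)); last by move=> x y; rewrite /rQ scalerBr.
by apply: eq_bigr => i _; rewrite contractPQE lract_comm.
Qed.

Lemma untwist_lact s q : untwist (lQ s q) = lQ s (untwist q).
Proof.
rewrite untwist_contract QP_inv_l (morphB_sum _ (contractQPB q)) /untwist.
rewrite (morphB_sum (h := lQ s)); last by move=> x y; rewrite /lQ scalerBr.
by apply: eq_bigr => i _; rewrite contractQPE lract_comm.
Qed.

(** These two equations say that [twist] and [untwist] exchange the two ways of
    contracting b (x) a (x) d. *)
Lemma twist_pair q p q' : twist (rQ q (f (PQ p q'))) = lQ (g (QP q p)) q'.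
Proof. by rewrite twist_contract fK contractPQE. Qed.

Lemma untwist_pair q p q' : untwist (lQ (g (QP q p)) q') = rQ q (f (PQ p q')).
Proof. by rewrite untwist_contract gK contractQPE. Qed.

Lemma twistD q q' : twist (q + q') = twist q + twist q'.
Proof.
rewrite /twist -big_split; apply: eq_bigr => i _ /=.
by rewrite pureDl raddfD lactDl.
Qed.

Lemma untwistD q q' : untwist (q + q') = untwist q + untwist q'.
Proof.
rewrite /untwist -big_split; apply: eq_bigr => i _ /=.
by rewrite pureDr raddfD ractDr.
Qed.

Lemma untwistB : {morph untwist : q q' / q - q'}.
Proof.
move=> q q'; apply/eqP; rewrite eq_sym subr_eq -untwistD subrK //.
Qed.

Lemma twistB : {morph twist : q q' / q - q'}.
Proof.
move=> q q'; apply/eqP; rewrite eq_sym subr_eq -twistD subrK //.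
Qed.

Lemma twistK : cancel twist untwist.
Proof.
move=> q; rewrite {1}/twist (morphB_sum _ untwistB); under eq_bigr do rewrite untwist_pair.
rewrite -(morphB_sum (h := rQ q)); last first.
  move=> r r'; apply/eqP; rewrite eq_sym subr_eq -ractDr subrK //.
by rewrite -raddf_sum -f1 f'K ract1.
Qed.

Lemma untwistK : cancel untwist twist.
Proof.
move=> q; rewrite {1}/untwist (morphB_sum _ twistB); under eq_bigr do rewrite twist_pair.
rewrite -(morphB_sum (h := lQ^~ q)); last first.
  move=> r r'; apply/eqP; rewrite eq_sym subr_eq -lactDl subrK //.
by rewrite -raddf_sum -g1 g'K lact1.
Qed.

Lemma morita_invertible_bimodule_aux : invertible_bimodule R S.
Proof.
refine (@InvBimodule k R S Q P lQ rQ (fun p q => f (PQ p (twist q)))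
  (fun q p => g (QP q p)) lactDl lactA lact1 ractDr ractA
  (fun s q r => esym (lract_comm s q r)) act_scal _ _ _ _ _ _ _).
- by move=> p q q'; rewrite twistD pureDr raddfD.
- by move=> p q r; rewrite twist_ract PQ_iso_r.
- by move=> q q' p; rewrite pureDl raddfD.
- by move=> s q p; rewrite QP_iso_l.
- by move=> q p q'; rewrite -untwist_pair untwist_lact twistK.
- exists n, a, (fun i => untwist (b i)).
  under eq_bigr do rewrite untwistK.
  by rewrite -raddf_sum -f1 f'K.
- by exists m, c, d; rewrite -raddf_sum -g1 g'K.
Qed.

End MoritaContext.

Lemma morita_invertible_bimodule (k : comPzRingType) (R S : kalgType k) :
  morita_equivalent R S -> inhabited (invertible_bimodule R S).
Proof.
case=> P [Q [[f [[f' fK f'K] fM]] [g [[g' gK g'K] gM]]]].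
have [n [a [b f1]]] := tens_sum (f' 1).
have [m [c [d g1]]] := tens_sum (g' 1).
apply: inhabits.
exact: (morita_invertible_bimodule_aux fK f'K gK g'K fM gM f1 g1).
Qed.

(** * Transport of the cocycle *)

(** A finite generating family makes s a matrix over R, [to_mx], which is
    multiplicative but not unital, and [of_mx] returns from matrices to S as a
    bimodule map.  In the other direction [entry] makes x in R a matrix over S. *)
Section Transport.
Variables (k : comPzRingType) (R S : kalgType k) (V : zmodType).
Variable B : invertible_bimodule R S.
Variables (t : {additive R -> V}) (d1 d2 : {additive R -> R}).
Hypotheses (tC : is_trace t) (d1M : is_derivation d1) (d2M : is_derivation d2).
Hypotheses (d1Z : forall l, d1 (kscal l) = 0) (d2Z : forall l, d2 (kscal l) = 0).
Variables (m : nat) (q' : 'I_m -> ibQ B) (p' : 'I_m -> ibP B).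
Hypothesis qp1 : \sum_i qp (q' i) (p' i) = 1.
Variables (n : nat) (p : 'I_n -> ibP B) (q : 'I_n -> ibQ B).
Hypothesis pq1 : \sum_i pq (p i) (q i) = 1.

Lemma pq_sum (I : finType) (x : ibP B) (F : I -> ibQ B) :
  pq x (\sum_i F i) = \sum_i pq x (F i).
Proof.
apply: (big_morph (pq x)); first exact: pqD.
by apply: (addrI (pq x 0)); rewrite -pqD !addr0.
Qed.

Lemma qp_sum (I : finType) (x : ibP B) (F : I -> ibQ B) :
  qp (\sum_i F i) x = \sum_i qp (F i) x.
Proof.
apply: (big_morph ((@qp _ _ _ B)^~ x)); first by move=> y z; exact: qpD.
by apply: (addrI (qp 0 x)); rewrite -qpD !addr0.
Qed.

Lemma ibl_sum (I : finType) (x : ibQ B) (F : I -> S) :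
  ibl (\sum_i F i) x = \sum_i ibl (F i) x.
Proof.
apply: (big_morph ((@ibl _ _ _ B)^~ x)); first by move=> y z; exact: iblDl.
by apply: (addrI (ibl 0 x)); rewrite -iblDl !addr0.
Qed.

Lemma ibr_sum (I : finType) (x : ibQ B) (F : I -> R) :
  ibr x (\sum_i F i) = \sum_i ibr x (F i).
Proof.
apply: (big_morph (ibr x)); first exact: ibrDr.
by apply: (addrI (ibr x 0)); rewrite -ibrDr !addr0.
Qed.

Definition to_mx (s : S) : 'M[R]_m := \matrix_(i, j) pq (p' i) (ibl s (q' j)).

Definition of_mx (X : 'M[R]_m) : S := \sum_i \sum_j qp (ibr (q' i) (X i j)) (p' j).

Lemma to_mxD s s' : to_mx (s + s') = to_mx s + to_mx s'.
Proof. by apply/matrixP=> i j; rewrite !mxE iblDl pqD. Qed.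

Lemma to_mxM s s' : to_mx (s * s') = to_mx s *m to_mx s'.
Proof.
apply/matrixP=> i j; rewrite !mxE -{1}[s]mulr1 -qp1 mulr_sumr mulr_suml.
rewrite ibl_sum pq_sum; apply: eq_bigr => l _; rewrite !mxE -pqr.
by rewrite -qp_pq qpl iblA.
Qed.

Lemma to_mxZ l s : to_mx (kscal l * s) = (kscal l)%:M *m to_mx s.
Proof.
apply/matrixP=> i j; rewrite mul_scalar_mx !mxE -iblA ibZ pqr.
by rewrite kscalC.
Qed.

Lemma of_mxD X Y : of_mx (X + Y) = of_mx X + of_mx Y.
Proof.
rewrite /of_mx -big_split; apply: eq_bigr => i _; rewrite -big_split.
by apply: eq_bigr => j _; rewrite mxE ibrDr qpD.
Qed.

Lemma of_mx_mull s X : of_mx (to_mx s *m X) = s * of_mx X.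
Proof.
transitivity (\sum_l \sum_j \sum_i
    qp (ibr (q' i) (to_mx s i l * X l j)) (p' j)).
  rewrite /of_mx [LHS]exchange_big [RHS]exchange_big /=.
  apply: eq_bigr => j _; rewrite [RHS]exchange_big; apply: eq_bigr => i _ /=.
  by rewrite mxE ibr_sum qp_sum.
rewrite mulr_sumr; apply: eq_bigr => l _.
rewrite mulr_sumr; apply: eq_bigr => j _.
rewrite -qpl -[in RHS](mul1r s) -qp1 mulr_suml ibl_sum qp_sum.
by apply: eq_bigr => i _; rewrite mxE -iblA iblr qp_pq pqr.
Qed.

Lemma of_mx_mulr s X : of_mx (X *m to_mx s) = of_mx X * s.
Proof.
rewrite mulr_suml; apply: eq_bigr => i _.
transitivity (\sum_j \sum_l qp (ibr (q' i) (X i l * to_mx s l j)) (p' j)).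
  by apply: eq_bigr => j _; rewrite mxE ibr_sum qp_sum.
rewrite exchange_big mulr_suml; apply: eq_bigr => l _ /=.
rewrite -[s in RHS]mulr1 -qp1 !mulr_sumr.
apply: eq_bigr => j _.
by rewrite mulrA -qpl -iblA qp_pq ibrA mxE.
Qed.

Lemma of_mxZl l X : of_mx ((kscal l)%:M *m X) = kscal l * of_mx X.
Proof.
rewrite mulr_sumr; apply: eq_bigr => i _; rewrite mulr_sumr.
apply: eq_bigr => j _.
by rewrite mul_scalar_mx mxE kscalC -ibrA -ibZ qpl.
Qed.

Lemma map_mxM_derivation (d : {additive R -> R}) (X Y : 'M[R]_m) :
  is_derivation d ->
  map_mx d (X *m Y) = map_mx d X *m Y + X *m map_mx d Y.
Proof.
move=> dM; apply/matrixP=> i j; rewrite !mxE raddf_sum -big_split /=.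
by apply: eq_bigr => l _; rewrite !mxE dM.
Qed.

Lemma map_mxZ_derivation (d : {additive R -> R}) l (X : 'M[R]_m) :
  is_derivation d -> d (kscal l) = 0 ->
  map_mx d ((kscal l)%:M *m X) = (kscal l)%:M *m map_mx d X.
Proof.
move=> dM dl; apply/matrixP=> i j.
by rewrite !mul_scalar_mx !mxE dM dl mul0r add0r.
Qed.

(** The cocycle d1(r1) d2(r2) of R, read on S. *)
Definition transport_fun s s' : S :=
  of_mx (map_mx d1 (to_mx s) *m map_mx d2 (to_mx s')).

Lemma scalar_mx_comm l (X : 'M[R]_m) : X *m (kscal l)%:M = (kscal l)%:M *m X.
Proof.
apply/matrixP=> i j; rewrite mul_scalar_mx !mxE (bigD1 j) //= big1 => [|i' ne].
  by rewrite !mxE eqxx kscalC addr0.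
by rewrite !mxE (negbTE ne) mulr0n mulr0.
Qed.

Definition transport_cocycle : cocycle S.
Proof.
refine (@Cocycle k S transport_fun _ _ _ _ _); rewrite /transport_fun.
- by move=> a b c; rewrite to_mxD map_mxD mulmxDl of_mxD.
- by move=> a b c; rewrite to_mxD map_mxD mulmxDr of_mxD.
- by move=> l a b; rewrite to_mxZ map_mxZ_derivation // -mulmxA of_mxZl.
- move=> l a b; rewrite to_mxZ map_mxZ_derivation // mulmxA scalar_mx_comm.
  by rewrite -mulmxA of_mxZl.
- move=> a b c; rewrite -of_mx_mull -of_mx_mulr !to_mxM.
  rewrite !map_mxM_derivation // -!of_mxD.
  congr of_mx; rewrite mulmxDl mulmxDr !mulmxA addrC addrAC -!addrA.
  by rewrite [RHS]addrC -addrA [RHS]addrCA.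
Defined.

Definition mx_trace (X : 'M[R]_m) : V := t (\tr X).

Lemma mx_traceC (X Y : 'M[R]_m) : mx_trace (X *m Y) = mx_trace (Y *m X).
Proof.
rewrite /mx_trace /mxtrace !raddf_sum /=.
transitivity (\sum_i \sum_j t (X i j * Y j i)).
  by apply: eq_bigr => i _; rewrite mxE raddf_sum.
rewrite exchange_big; apply: eq_bigr => i _; rewrite mxE raddf_sum.
by apply: eq_bigr => j _; exact: tC.
Qed.

(** The trace of S that corresponds to t (the Hattori-Stallings rule). *)
Definition mod_trace (s : S) : V := mx_trace (to_mx s).

Lemma mod_traceD s s' : mod_trace (s + s') = mod_trace s + mod_trace s'.
Proof. by rewrite /mod_trace /mx_trace to_mxD raddfD raddfD. Qed.

Lemma mod_trace_sum (I : finType) (F : I -> S) :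
  mod_trace (\sum_i F i) = \sum_i mod_trace (F i).
Proof.
apply: (big_morph mod_trace); first exact: mod_traceD.
by apply: (addrI (mod_trace 0)); rewrite -mod_traceD !addr0.
Qed.

Lemma mod_traceC s s' : mod_trace (s * s') = mod_trace (s' * s).
Proof. by rewrite /mod_trace !to_mxM mx_traceC. Qed.

Lemma mod_trace_qp (x : ibQ B) (y : ibP B) : mod_trace (qp x y) = t (pq y x).
Proof.
rewrite /mod_trace /mx_trace /mxtrace.
transitivity (t (\sum_i pq (p' i) x * pq y (q' i))).
  by congr (t _); apply: eq_bigr => i _; rewrite mxE qp_pq pqr.
rewrite raddf_sum /=; under eq_bigr do rewrite tC -pqr -qp_pq.
by rewrite -raddf_sum -pq_sum -ibl_sum qp1 ibl1.
Qed.

Lemma mod_trace_of_mx s X : mod_trace (s * of_mx X) = mx_trace (to_mx s *m X).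
Proof.
rewrite /mx_trace /mxtrace raddf_sum mulr_sumr mod_trace_sum /=.
transitivity (\sum_i \sum_j t (to_mx s j i * X i j)); last first.
  rewrite exchange_big; apply: eq_bigr => j _.
  by rewrite mxE raddf_sum.
apply: eq_bigr => i _; rewrite mulr_sumr mod_trace_sum.
apply: eq_bigr => j _.
by rewrite -qpl mod_trace_qp mxE iblr pqr.
Qed.

Definition entry (a b : 'I_n) (x : R) : S := qp (ibr (q a) x) (p b).

Lemma entry_mul a c x y : \sum_b entry a b x * entry b c y = entry a c (x * y).
Proof.
rewrite /entry; under eq_bigr do rewrite -qpl qp_pq pqr.
by rewrite -qp_sum -ibr_sum -mulr_suml pq1 mul1r ibrA.
Qed.

Lemma to_mx_entry a b x i j :
  to_mx (entry a b x) i j = pq (p' i) (q a) * x * pq (p b) (q' j).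
Proof. by rewrite mxE /entry qp_pq !pqr. Qed.

(** The transported cyclic cocycle on the chain (1, x, y), written in S; the first
    entry is the matrix of 1, an idempotent and not the identity matrix. *)
Definition transported x y : V := \sum_a \sum_b \sum_c
  mod_trace (entry a b 1 * transport_fun (entry b c x) (entry c a y)).

(** Since transport_fun is the coboundary of D, its value on (1, x, y) is a term
    in xy minus an expression symmetric in x and y. *)
Lemma transported_symmetric (D : {additive S -> S}) x y :
  (forall s s', D (s * s') = s * D s' + D s * s' + transport_fun s s') ->
  x * y = y * x -> transported x y = transported y x.
Proof.
move=> DM xyC; pose S1 x y := \sum_a \sum_c mod_trace (entry a c x * D (entry c a y)).
pose S0 x := \sum_a \sum_b mod_trace (entry a b 1 * D (entry b a x)).
suff E x' y' : transported x' y' + (S1 x' y' + S1 y' x') = S0 (x' * y').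
  by apply: (addIr (S1 x y + S1 y x)); rewrite E xyC -E [S1 x y + _]addrC.
have S1E : S1 x' y' = \sum_a \sum_b \sum_c
    mod_trace (entry a b 1 * (entry b c x' * D (entry c a y'))).
  apply: eq_bigr => a _; rewrite exchange_big; apply: eq_bigr => c _ /=.
  rewrite -mod_trace_sum -[x' in LHS]mul1r -entry_mul mulr_suml.
  by congr mod_trace; apply: eq_bigr => b _; rewrite mulrA.
have S1E' : S1 y' x' = \sum_a \sum_b \sum_c
    mod_trace (entry a b 1 * (D (entry b c x') * entry c a y')).
  rewrite /S1 [RHS](_ : _ = \sum_c \sum_b \sum_a
    mod_trace (entry c a y' * entry a b 1 * D (entry b c x'))); last first.
    rewrite exchange_big [RHS]exchange_big; apply: eq_bigr => b _ /=.
    rewrite exchange_big; apply: eq_bigr => c _; apply: eq_bigr => a _ /=.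
    by rewrite mulrA mod_traceC mulrA.
  apply: eq_bigr => c _; apply: eq_bigr => b _.
  by rewrite -mod_trace_sum -mulr_suml entry_mul mulr1.
rewrite S1E S1E' /transported /S0 -!big_split; apply: eq_bigr => a _ /=.
rewrite -!big_split; apply: eq_bigr => b _ /=; rewrite -!big_split /=.
rewrite -entry_mul raddf_sum mulr_sumr mod_trace_sum; apply: eq_bigr => c _ /=.
by rewrite -!mod_traceD DM -!mulrDr addrC.
Qed.

Let v (i : 'I_m * 'I_n) := pq (p' i.1) (q i.2).
Let u (i : 'I_m * 'I_n) := pq (p i.2) (q' i.1).

(** Both sides are the same sum over pairs of an index of q' and an index of q. *)
Lemma transported_induced x y : transported x y = induced_cocycle t d1 d2 v u x y.
Proof.
pose F a b c i j l := t (v (i, a) * u (j, b) * d1 (v (j, b) * x * u (l, c))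
                          * d2 (v (l, c) * y * u (i, a))).
have pairE (G : 'I_n -> 'I_m -> V) :
    \sum_(z : 'I_m * 'I_n) G z.2 z.1 = \sum_a \sum_i G a i.
  by rewrite -(pair_bigA _ (fun i a => G a i)) exchange_big.
transitivity (\sum_a \sum_i \sum_b \sum_j \sum_c \sum_l F a b c i j l); last first.
  rewrite -pairE /induced_cocycle; apply: eq_bigr => -[i a] _.
  rewrite -pairE; apply: eq_bigr => -[j b] _.
  by rewrite -pairE; apply: eq_bigr => -[l c] _.
apply: eq_bigr => a _.
transitivity (\sum_b \sum_c \sum_i \sum_j \sum_l F a b c i j l); last first.
  under eq_bigr do rewrite exchange_big /=.
  rewrite exchange_big /=; apply: eq_bigr => i _; apply: eq_bigr => b _.
  by rewrite exchange_big.
apply: eq_bigr => b _; apply: eq_bigr => c _.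
rewrite mod_trace_of_mx /mx_trace /mxtrace raddf_sum; apply: eq_bigr => i _ /=.
rewrite mxE raddf_sum; apply: eq_bigr => j _ /=.
rewrite [X in _ * X]mxE mulr_sumr raddf_sum; apply: eq_bigr => l _ /=.
by rewrite to_mx_entry mulr1 !(mxE, to_mx_entry) /F mulrA.
Qed.

Lemma uv1 : \sum_i u i * v i = 1.
Proof.
rewrite -(pair_bigA _ (fun i a => u (i, a) * v (i, a))) exchange_big /= -pq1.
apply: eq_bigr => a _; rewrite /u /v /=.
under eq_bigr do rewrite -pqr -qp_pq.
by rewrite -pq_sum -ibl_sum qp1 ibl1.
Qed.

(** The cocycle has value t(xy) on a cycle but is a coboundary. *)
Lemma transport_contradiction x y : quasi_free S ->
  x * y = y * x -> d1 x = x -> d2 y = y -> d1 y = 0 -> d2 x = 0 -> t (x * y) = 0.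
Proof.
move=> /(quasi_free_coboundary transport_cocycle)[D DM] xyC d1x d2y d1y d2x.
have := induced_cocycle_comm tC d1M d2M uv1 xyC d1x d2y d1y d2x.
rewrite -!transported_induced (transported_symmetric DM xyC).
by rewrite -{1}[transported y x]addr0 => /addrI.
Qed.

End Transport.

(** * Tensor products *)

(** The class of dx in HH_1 is nonzero, detected by the pairing of (a0, a1) with
    t(a0 d(a1)): its value on (1, x) is t(d x) = 1. *)
Definition eigen_trace (k : comPzRingType) (A : kalgType k) : Prop :=
  exists (d : {additive A -> A}) (t : {additive A -> k}) (x : A),
    [/\ is_derivation d /\ (forall l, d (kscal l) = 0),
        is_trace t /\ (forall l a, t (kscal l * a) = l * t a),
        d x = x & t x = 1].

Section TensorProduct.
Variables (k : comPzRingType) (A B : kalgType k).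

Lemma tensA_ind (C : (A ⊗ B)%type -> Prop) :
  (forall a b, C (pureA a b)) -> (forall t u, C t -> C u -> C (t - u)) ->
  forall t, C t.
Proof. exact: tens_ind. Qed.

Section Map.
Variables (f : {additive A -> A}) (g : {additive B -> B}).
Hypotheses (fZ : forall l a, f (kscal l * a) = kscal l * f a).
Hypotheses (gZ : forall l b, g (kscal l * b) = kscal l * g b).

Definition tens_map_fun (u : A ⊗ B) : (A ⊗ B)%type :=
  tens_lift (fun a b => pureA (f a) (g b)) u.

Fact tens_map_bal (h := fun a b => pureA (f a) (g b) : (A ⊗ B)%type) :
  [/\ forall a a' b, h (a + a') b = h a b + h a' b,
      forall a b b', h a (b + b') = h a b + h a b' &
      forall a l b, h (kactr a l) b = h a (kactl l b)].
Proof.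
rewrite /h; split=> [a a' b|a b b'|a l b].
- by rewrite raddfD /pureA pureDl.
- by rewrite raddfD /pureA pureDr.
- by rewrite /kactr /kactl fZ gZ; exact: pureZ.
Qed.

Fact tens_mapB : {morph tens_map_fun : u v / u - v}.
Proof. by case: tens_map_bal => H1 H2 H3; apply: (tens_liftB H1 H2 H3). Qed.

Definition tens_map := additive_of tens_mapB.

Lemma tens_mapE a b : tens_map (pureA a b) = pureA (f a) (g b).
Proof. by case: tens_map_bal => H1 H2 H3; apply: (tens_liftE H1 H2 H3). Qed.

Lemma tens_map_derivation :
  (forall a b a' b', pureA (f (a * a')) (g (b * b')) =
     pureA (f a * a') (g b * b') + pureA (a * f a') (b * g b') :> (A ⊗ B)%type) ->
  is_derivation tens_map.
Proof.
move=> fgM u v; elim/tensA_ind: u => [a b|? ? IH IH']; last first.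
  by rewrite mulrBl !raddfB IH IH'; ncring.
elim/tensA_ind: v => [a' b'|? ? IH IH']; last first.
  by rewrite mulrBr !raddfB IH IH'; ncring.
by rewrite !(pureA_mul, tens_mapE).
Qed.

End Map.

Lemma pureA0l b : pureA 0 b = 0 :> (A ⊗ B)%type.
Proof. by apply: (addrI (pureA 0 b)); rewrite /pureA -pureDl !addr0. Qed.

Lemma pureA0r a : pureA a 0 = 0 :> (A ⊗ B)%type.
Proof. by apply: (addrI (pureA a 0)); rewrite /pureA -pureDr !addr0. Qed.

Lemma pureA_scal l : pureA (kscal l) 1 = pureA 1 (kscal l) :> (A ⊗ B)%type.
Proof.
by rewrite -[kscal l in LHS]mulr1 -[kscal l in RHS]mulr1; exact: pureZ.
Qed.

Section Trace.
Variables (s : {additive A -> k}) (t : {additive B -> k}).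
Hypotheses (sC : is_trace s) (tC : is_trace t).
Hypotheses (sZ : forall l a, s (kscal l * a) = l * s a).
Hypotheses (tZ : forall l b, t (kscal l * b) = l * t b).

Definition tens_trace_fun (u : A ⊗ B) : k := tens_lift (fun a b => s a * t b) u.

Fact tens_trace_bal (h := fun a b => s a * t b) :
  [/\ forall a a' b, h (a + a') b = h a b + h a' b,
      forall a b b', h a (b + b') = h a b + h a b' &
      forall a l b, h (kactr a l) b = h a (kactl l b)].
Proof.
rewrite /h; split=> [a a' b|a b b'|a l b].
- by rewrite raddfD mulrDl.
- by rewrite raddfD mulrDr.
- by rewrite /kactr /kactl sZ tZ mulrCA mulrA.
Qed.

Fact tens_traceB : {morph tens_trace_fun : u v / u - v}.
Proof. by case: tens_trace_bal => H1 H2 H3; apply: (tens_liftB H1 H2 H3). Qed.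

Definition tens_trace := additive_of tens_traceB.

Lemma tens_traceE a b : tens_trace (pureA a b) = s a * t b.
Proof. by case: tens_trace_bal => H1 H2 H3; apply: (tens_liftE H1 H2 H3). Qed.

Lemma tens_traceC : is_trace tens_trace.
Proof.
move=> u v; elim/tensA_ind: u => [a b|? ? IH IH']; last first.
  by rewrite mulrBl mulrBr !raddfB IH IH'.
elim/tensA_ind: v => [a' b'|? ? IH IH']; last first.
  by rewrite mulrBl mulrBr !raddfB IH IH'.
by rewrite !pureA_mul !tens_traceE sC tC.
Qed.

End Trace.
End TensorProduct.

Lemma derivation_scal (k : comPzRingType) (A : kalgType k) (d : {additive A -> A}) :
  is_derivation d -> (forall l, d (kscal l) = 0) ->
  forall l a, d (kscal l * a) = kscal l * d a.
Proof. by move=> dM dZ l a; rewrite dM dZ mul0r add0r. Qed.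

(** The two HH_1 classes multiply to a class in HH_2 of the tensor product, while
    HH_2 of S vanishes. *)
Lemma eigen_trace_not_morita (k : fieldType) (A B S : kalgType k) :
  eigen_trace A -> eigen_trace B -> quasi_free S ->
  ~ morita_equivalent (A ⊗ B)%type S.
Proof.
case=> d [s [x [[dM d0] [sC sZ] dx sx]]] [e [t [y [[eM e0] [tC tZ] ey ty]]]] Sqf.
case/morita_invertible_bimodule => M.
have [m [q' [p' qp1]]] := qp_unit M; have [n [p [q pq1]]] := pq_unit M.
have dZ := derivation_scal dM d0; have eZ := derivation_scal eM e0.
pose iA : {additive A -> A} := idfun; pose iB : {additive B -> B} := idfun.
have iAZ l a : iA (kscal l * a) = kscal l * iA a by [].
have iBZ l b : iB (kscal l * b) = kscal l * iB b by [].
pose D1 := tens_map dZ iBZ; pose D2 := tens_map iAZ eZ.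
have D1M : is_derivation D1.
  by apply: tens_map_derivation => a b a' b'; rewrite dM /pureA pureDl.
have D2M : is_derivation D2.
  by apply: tens_map_derivation => a b a' b'; rewrite eM /pureA pureDr.
have D1Z l : D1 (kscal l) = 0 by rewrite tens_mapE d0 pureA0l.
have D2Z l : D2 (kscal l) = 0.
  by rewrite [kscal l]pureA_scal tens_mapE e0 pureA0r.
pose tau := tens_trace sZ tZ.
have tauC : is_trace tau by exact: tens_traceC.
have /eqP : tau (pureA x 1 * pureA 1 y) = 0.
  apply: (transport_contradiction tauC D1M D2M D1Z D2Z qp1 pq1 Sqf).
  - by rewrite !pureA_mul !mulr1 !mul1r.
  - by rewrite tens_mapE dx.
  - by rewrite tens_mapE ey.
  - by rewrite tens_mapE (derivation1 dM) pureA0l.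
  - by rewrite tens_mapE (derivation1 eM) pureA0r.
by rewrite pureA_mul mulr1 mul1r tens_traceE sx ty mulr1 oner_eq0.
Qed.

(** * Presented algebras *)

Section LinearExtension.
Variables (k : fieldType) (I : choiceType) (V : zmodType).
Variable F : k -> {fmonom I} -> V.
Hypothesis FB : forall m, {morph F^~ m : a b / a - b}.

Local Notation A := (freeA k I).

Definition lin_ext_fun (x : A) : V :=
  \sum_(m <- msupp (x : {malg k[{fmonom I}]})) F (x : {malg k[{fmonom I}]})@_m m.

Fact lin_ext_coef0 m : F 0 m = 0.
Proof. by have := FB m 0 0; rewrite /= !subrr. Qed.

Fact lin_ext_funEw (d : {fset {fmonom I}}) (x : {malg k[{fmonom I}]}) :
  (msupp x `<=` d)%fset -> lin_ext_fun x = \sum_(m <- d) F x@_m m.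
Proof.
by move=> le; apply/big_fset_incl => // m _ /mcoeff_outdom ->; exact: lin_ext_coef0.
Qed.

Fact lin_extB : {morph lin_ext_fun : x y / x - y}.
Proof.
move=> x y; pose x' := x : {malg k[{fmonom I}]}; pose y' := y : {malg k[{fmonom I}]}.
pose d := (msupp x' `|` msupp y')%fset.
rewrite (@lin_ext_funEw d x) ?(@lin_ext_funEw d y) ?fsubsetUl ?fsubsetUr //.
rewrite (@lin_ext_funEw d (x - y)) ?msuppB_le // -sumrB.
by apply: eq_bigr => m _; rewrite mcoeffB; exact: FB.
Qed.

Definition lin_ext : {additive A -> V} := additive_of lin_extB.

Lemma lin_extU c m : lin_ext (<< c *g m >> : {malg k[{fmonom I}]}) = F c m.
Proof.
rewrite [LHS](@lin_ext_funEw [fset m]%fset) ?msuppU_le //.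
by rewrite big_seq_fset1 mcoeffUU.
Qed.

End LinearExtension.

(** These arguments use only that the algebra is spanned by words, which multiply
    by concatenation. *)
Section SpannedByWords.
Variables (k : pzRingType) (I : Type) (A : kalgType k) (w : seq I -> A).
Hypothesis w_ind : forall C : A -> Prop,
  C 0 -> (forall x y, C x -> C y -> C (x + y)) ->
  (forall c s, C (kscal c * w s)) -> forall x, C x.
Hypotheses (w0 : w [::] = 1) (wM : forall s s', w (s ++ s') = w s * w s').

Lemma words_mul c d s s' :
  (kscal c * w s) * (kscal d * w s') = kscal (c * d) * w (s ++ s').
Proof.
by rewrite wM kscalM -!mulrA; congr (_ * _); rewrite !mulrA kscalC.
Qed.

Lemma words_monoid_morphism (T : kalgType k) (f : A -> T) (v : seq I -> T) :
  {morph f : x y / x - y} -> (forall c s, f (kscal c * w s) = kscal c * v s) ->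
  v [::] = 1 -> (forall s s', v (s ++ s') = v s * v s') -> monoid_morphism f.
Proof.
move=> fB fw v0 vM; have fD := morphB_morphD fB.
have f0 : f 0 = 0 by rewrite -(subrr 0) fB subrr.
split=> [|x y]; first by rewrite -[1]mulr1 -{1}kscal1 -w0 fw kscal1 v0 mulr1.
elim/w_ind: x => [|x x' Hx Hx'|c s]; first by rewrite !(mul0r, f0).
  by rewrite mulrDl !fD Hx Hx' mulrDl.
elim/w_ind: y => [|y y' Hy Hy'|d s']; first by rewrite !(mulr0, f0).
  by rewrite mulrDr !fD Hy Hy' mulrDr.
rewrite words_mul !fw vM kscalM !mulrA; congr (_ * _).
by rewrite -!mulrA (kscalC d).
Qed.

Lemma words_trace (V : zmodType) (f : {additive A -> V}) :
  (forall c s s', f (kscal c * w (s ++ s')) = f (kscal c * w (s' ++ s))) ->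
  (forall c d : k, c * d = d * c) -> is_trace f.
Proof.
move=> fw kC x y; elim/w_ind: x => [|x x' Hx Hx'|c s].
- by rewrite mulr0 mul0r.
- by rewrite mulrDl mulrDr !raddfD Hx Hx'.
elim/w_ind: y => [|y y' Hy Hy'|d s'].
- by rewrite mulr0 mul0r.
- by rewrite mulrDl mulrDr !raddfD Hy Hy'.
by rewrite !words_mul fw kC.
Qed.

End SpannedByWords.

Section FreeAlgebraTheory.
Variables (k : fieldType) (I : choiceType).
Local Notation A := (freeA k I).

Definition word (s : seq I) : A := \prod_(i <- s) gen k i.

Lemma wordE (m : {fmonom I}) : word m = << m >> :> {malg k[{fmonom I}]}.
Proof.
case: m => s; rewrite /word /=; elim: s => [|i s IHs].
  by rewrite big_nil; congr << _ >>; rewrite -fmoneE.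
rewrite big_cons IHs; apply: etrans (fgmulUU _ _ _ _) _.
by rewrite mulr1; congr << _ >>; rewrite /mmul /= fmmulE fmuE.
Qed.

Lemma freeA_ind (C : A -> Prop) :
  C 0 -> (forall x y, C x -> C y -> C (x + y)) ->
  (forall c s, C (kscal c * word s)) -> forall x, C x.
Proof.
move=> C0 CD Cw x; rewrite [x]monalgE; elim/big_ind: _ => // m _.
rewrite (_ : << _ *g m >> = kscal ((x : {malg k[{fmonom I}]})@_m) * word m) //.
rewrite wordE; apply: etrans _ (esym (fgmulUU _ _ _ _)).
by rewrite mul1m mulr1.
Qed.

Lemma lin_extE (V : zmodType) (F : k -> {fmonom I} -> V)
    (FB : forall m, {morph F^~ m : a b / a - b}) c s :
  lin_ext FB (kscal c * word s) = F c (FMonom s).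
Proof.
rewrite -(lin_extU FB); congr (lin_ext FB _).
rewrite (wordE (FMonom s)); apply: etrans (fgmulUU _ _ _ _) _.
by rewrite mul1m mulr1.
Qed.

Variables (T : kalgType k) (g : I -> T).

Fact word_valB (m : {fmonom I}) :
  {morph (fun c => kscal c * \prod_(i <- m) g i : T) : a b / a - b}.
Proof. by move=> a b; rewrite kscalB mulrBl. Qed.

Definition alg_lift_fun (x : A) : T := lin_ext word_valB x.

Fact alg_liftB : {morph alg_lift_fun : x y / x - y}.
Proof. by move=> x y; rewrite /alg_lift_fun raddfB. Qed.

Fact alg_lift_word c s : alg_lift_fun (kscal c * word s) = kscal c * \prod_(i <- s) g i.
Proof. by rewrite /alg_lift_fun lin_extE. Qed.

Lemma word_cat s s' : word (s ++ s') = word s * word s'.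
Proof. exact: big_cat. Qed.

Fact alg_liftM : monoid_morphism alg_lift_fun.
Proof.
apply: (words_monoid_morphism freeA_ind _ word_cat alg_liftB alg_lift_word).
- by rewrite /word big_nil.
- by rewrite big_nil.
- by move=> s s'; rewrite big_cat.
Qed.

HB.instance Definition _ := GRing.isZmodMorphism.Build A T alg_lift_fun alg_liftB.
HB.instance Definition _ := GRing.isMonoidMorphism.Build A T alg_lift_fun alg_liftM.
Definition alg_lift : {rmorphism A -> T} := alg_lift_fun.

Lemma alg_lift_gen i : alg_lift (gen k i) = g i.
Proof.
have := alg_lift_word 1 [:: i].
by rewrite /word !big_seq1 !kscal1 !mul1r.
Qed.

Lemma alg_lift_scal c : alg_lift (kscal c) = kscal c.
Proof.
by have := alg_lift_word c [::]; rewrite /word !big_nil !mulr1.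
Qed.

End FreeAlgebraTheory.

Section AlgebraQuotientTheory.
Variables (k : fieldType) (F : kalgType k) (rel : F -> F -> Prop).
Local Notation Q := (aquot rel).

Lemma api_scal c : api rel (kscal c) = kscal c.
Proof. by []. Qed.

Lemma api_eq x y : api rel x = api rel y -> subgroup (ideal_gen rel) (x - y).
Proof. by with_strategy transparent [api aquot] move/zpi_eq. Qed.

Lemma api_surj (t : Q) : exists x, t = api rel x.
Proof. by exists (arepr t); rewrite areprK. Qed.

Section Lift.
Variables (V : zmodType) (f : {additive F -> V}).
Hypothesis f_ideal : forall a x y b, rel x y -> f (a * (x - y) * b) = 0.

Definition aquot_lift_fun (t : Q) : V := f (arepr t).

Fact aquot_lift_api x : aquot_lift_fun (api rel x) = f x.
Proof.
apply/eqP; rewrite /aquot_lift_fun -subr_eq0 -raddfB; apply/eqP.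
have /api_eq := areprK (api rel x).
elim=> [_ [a u v b r]||u v _ Hu _ Hv]; first exact: f_ideal.
  exact: raddf0.
by rewrite raddfB Hu Hv subrr.
Qed.

Fact aquot_liftB : {morph aquot_lift_fun : t u / t - u}.
Proof.
move=> t u; have [x ->] := api_surj t; have [y ->] := api_surj u.
by rewrite -raddfB !aquot_lift_api raddfB.
Qed.

Definition aquot_lift : {additive Q -> V} := additive_of aquot_liftB.

Lemma aquot_liftE x : aquot_lift (api rel x) = f x.
Proof. exact: aquot_lift_api. Qed.

End Lift.

Section LiftMorphism.
Variables (T : kalgType k) (f : {rmorphism F -> T}).
Hypothesis f_rel : forall x y, rel x y -> f x = f y.

Fact rmorph_ideal a x y b : rel x y -> f (a * (x - y) * b) = 0.
Proof. by move=> r; rewrite !rmorphM rmorphB (f_rel r) subrr mulr0 mul0r. Qed.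

Definition aquot_rlift_fun (t : Q) : T := aquot_lift rmorph_ideal t.

Fact aquot_rliftB : {morph aquot_rlift_fun : t u / t - u}.
Proof. by move=> t u; rewrite /aquot_rlift_fun raddfB. Qed.

Fact aquot_rliftM : monoid_morphism aquot_rlift_fun.
Proof.
rewrite /aquot_rlift_fun; split=> [|t u].
  by rewrite -(rmorph1 (api rel)) aquot_liftE /= rmorph1.
have [x ->] := api_surj t; have [y ->] := api_surj u.
by rewrite -rmorphM !aquot_liftE /= rmorphM.
Qed.

HB.instance Definition _ :=
  GRing.isZmodMorphism.Build Q T aquot_rlift_fun aquot_rliftB.
HB.instance Definition _ :=
  GRing.isMonoidMorphism.Build Q T aquot_rlift_fun aquot_rliftM.
Definition aquot_rlift : {rmorphism Q -> T} := aquot_rlift_fun.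

Lemma aquot_rliftE x : aquot_rlift (api rel x) = f x.
Proof. by rewrite /aquot_rlift /= /aquot_rlift_fun aquot_liftE. Qed.

End LiftMorphism.
End AlgebraQuotientTheory.

Section Presentation.
Variables (k : fieldType) (I : choiceType) (rel : freeA k I -> freeA k I -> Prop).
Local Notation A := (aquot rel).
Local Notation gn i := (api rel (gen k i)).

Lemma presented_hom (T : kalgType k) (g : I -> T) :
  (forall x y, rel x y -> alg_lift g x = alg_lift g y) ->
  exists f : {rmorphism A -> T}, klinear_hom f /\ forall i, f (gn i) = g i.
Proof.
move=> g_rel; exists (aquot_rlift g_rel); split=> [c|i].
  by rewrite -api_scal aquot_rliftE alg_lift_scal.
by rewrite aquot_rliftE alg_lift_gen.
Qed.

Lemma presented_eq (T : kalgType k) (f g : {rmorphism A -> T}) :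
  klinear_hom f -> klinear_hom g -> (forall i, f (gn i) = g (gn i)) -> f =1 g.
Proof.
move=> fk gk fg t; have [x ->] := api_surj t.
elim/freeA_ind: x => [|x y Hx Hy|c s]; first by rewrite !rmorph0.
  by rewrite !rmorphD Hx Hy.
rewrite !rmorphM /= !api_scal fk gk; congr (_ * _).
by rewrite /word !rmorph_prod; apply: eq_bigr => i _; exact: fg.
Qed.

Lemma presented_section (T : kalgType k) (f : {rmorphism T -> A}) (g : I -> T) :
  klinear_hom f -> (forall i, f (g i) = gn i) ->
  (forall x y, rel x y -> alg_lift g x = alg_lift g y) ->
  exists h : {rmorphism A -> T}, [/\ klinear_hom h, cancel h f & forall i, h (gn i) = g i].
Proof.
move=> fk fg /presented_hom[h [hk hg]]; exists h; split=> //.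
apply: (presented_eq (f := f \o h) (g := idfun)) => [c|c|i] //=.
  by rewrite hk fk.
by rewrite hg fg.
Qed.

End Presentation.

Section PresentedDerivation.
Variables (k : fieldType) (I : choiceType) (rel : freeA k I -> freeA k I -> Prop).
Local Notation A := (aquot rel).
Local Notation gn i := (api rel (gen k i)).

(** A derivation is a homomorphism to the dual numbers, so on a presented algebra it
    is given by its values on generators, subject to the relations. *)
Lemma presented_derivation (w : I -> A) :
  (forall x y, rel x y ->
     alg_lift (fun i => (gn i, w i) : cocycle_ext (zero_cocycle A)) x
     = alg_lift (fun i => (gn i, w i) : cocycle_ext (zero_cocycle A)) y) ->
  exists d : {additive A -> A},
    [/\ is_derivation d, forall l, d (kscal l) = 0 & forall i, d (gn i) = w i].
Proof.
case/(presented_section (f := @ext_proj k A (zero_cocycle A))) => // h [hk hK hw].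
have [d [dM dk hd]] := section_derivation hk hK.
by exists d; split=> // i; rewrite -hd hw.
Qed.

End PresentedDerivation.

(** * Lifting along square-zero ideals *)

Section SquareZeroLifting.
Variables (T S : pzRingType) (f : {rmorphism T -> S}).
Hypothesis sq0 : forall x y, f x = 0 -> f y = 0 -> x * y = 0.

(** Write Y i X j = delta + W i j with W in the kernel.  The error W i j is removed
    by correcting Y i when j < i and X j when i <= j: each correction is then a
    finite sum, although the families are infinite. *)
Lemma lift_dual_families (X Y : nat -> T) :
  (forall i j, f (Y i) * f (X j) = (i == j)%:R) ->
  exists X' Y' : nat -> T, [/\ forall i, f (X' i) = f (X i),
    forall i, f (Y' i) = f (Y i) & forall i j, Y' i * X' j = (i == j)%:R].
Proof.
move=> fYX; pose W i j := Y i * X j - (i == j)%:R.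
have fW i j : f (W i j) = 0 by rewrite rmorphB rmorphM fYX rmorph_nat subrr.
have YX i j : Y i * X j = (i == j)%:R + W i j by rewrite /W addrC subrK.
exists (fun j => X j - \sum_(l < j.+1) X l * W l j).
exists (fun i => Y i - \sum_(l < i) W i l * Y l); split=> [j|i|i j].
- rewrite rmorphB rmorph_sum big1 ?subr0 // => l _.
  by rewrite rmorphM fW mulr0.
- rewrite rmorphB rmorph_sum big1 ?subr0 // => l _.
  by rewrite rmorphM fW mul0r.
have E1 : (\sum_(l < i) W i l * Y l) * X j = W i j *+ (j < i)%N.
  rewrite mulr_suml; under eq_bigr => l _.
    rewrite -mulrA YX mulrDr (sq0 (fW _ _) (fW _ _)) addr0 mulr_natr; over.
  case: ltnP => [ji|ij].
    rewrite (bigD1 (Ordinal ji)) //= eqxx big1 ?addr0 // => l ne.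
    by rewrite -val_eqE /= in ne; rewrite (negbTE ne).
  by rewrite big1 // => l _; rewrite ltn_eqF // (leq_trans _ ij).
have E2 : Y i * (\sum_(l < j.+1) X l * W l j) = W i j *+ (i <= j)%N.
  rewrite mulr_sumr; under eq_bigr => l _.
    rewrite mulrA YX mulrDl (sq0 (fW _ _) (fW _ _)) addr0 mulr_natl; over.
  rewrite -ltnS; case: ltnP => [ij|ji].
    rewrite (bigD1 (Ordinal ij)) //= eqxx big1 ?addr0 // => l ne.
    by rewrite -val_eqE eq_sym /= in ne; rewrite (negbTE ne).
  by rewrite big1 // => l _; rewrite gtn_eqF // (leq_trans _ ji).
have E3 : (\sum_(l < i) W i l * Y l) * (\sum_(l < j.+1) X l * W l j) = 0.
  apply: sq0; rewrite rmorph_sum big1 // => l _.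
    by rewrite rmorphM fW mul0r.
  by rewrite rmorphM fW mulr0.
rewrite mulrBl !mulrBr E1 E2 E3 YX subr0 leqNgt.
by case: (j < i)%N; rewrite !(subr0, addrK, addrN) //= mulr1n addrK.
Qed.

Section Idempotents.
Variables (V : finType) (e : V -> T).

(** The error W i j of the products is a 2-cocycle on the separable algebra spanned
    by the idempotents; D is its primitive, obtained by contracting with the
    separability idempotent, the sum of e l (x) e l.  The sum of the corrected
    idempotents is an idempotent congruent to 1, hence equal to 1. *)
Lemma lift_orthogonal_idempotents :
  (forall i j, f (e i) * f (e j) = f (e i) *+ (i == j)) -> \sum_i f (e i) = 1 ->
  exists P : V -> T, [/\ forall i, f (P i) = f (e i),
    forall i j, P i * P j = P i *+ (i == j) & \sum_i P i = 1].
Proof.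
move=> fee fe1; pose W i j := e i * e j - e i *+ (i == j).
have fW i j : f (W i j) = 0 by rewrite rmorphB rmorphM rmorphMn fee subrr.
have ee i j : e i * e j = e i *+ (i == j) + W i j by rewrite /W addrC subrK.
have sumW i j : (\sum_l e l) * W i j = W i j.
  apply/eqP; rewrite -subr_eq0 -[X in _ - X]mul1r -mulrBl; apply/eqP/sq0 => //.
  by rewrite rmorphB rmorph_sum fe1 rmorph1 subrr.
pose D i := \sum_l e l * W l i.
have fD i : f (D i) = 0.
  by rewrite rmorph_sum big1 // => l _; rewrite rmorphM fW mulr0.
have eD i j : e i * D j = e i * W i j.
  rewrite mulr_sumr (bigD1 i) //= mulrA ee eqxx mulrDl (sq0 (fW _ _) (fW _ _)).
  rewrite addr0 big1 ?addr0 // => l ne.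
  by rewrite mulrA ee eq_sym (negbTE ne) add0r sq0.
have De i j : D i * e j = D i *+ (i == j) + W i j - e i * W i j.
  have WE l : W l i * e j = W l i *+ (i == j) + e l * W i j - W i j *+ (l == i).
    by rewrite /W; case: (eqVneq l i) => [->|_]; case: (i == j); rewrite ?mulr1n ?mulr0n; ncring.
  have eeW l : e l * (e l * W i j) = e l * W i j.
    by rewrite mulrA ee eqxx mulrDl (sq0 (fW _ _) (fW _ _)) addr0.
  rewrite mulr_suml -{1}(sumW i j) mulr_suml.
  have -> : e i * W i j = \sum_l e l * (W i j *+ (l == i)).
    rewrite (bigD1 i) //= eqxx big1 ?addr0 // => l ne.
    by rewrite (negbTE ne) mulr0.
  rewrite /D -sumrMnl -big_split -sumrB; apply: eq_bigr => l _ /=.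
  by rewrite -mulrA WE mulrBr mulrDr eeW mulrnAr.
pose P i := e i - D i.
have PP i j : P i * P j = P i *+ (i == j).
  rewrite /P mulrBl !mulrBr eD De (sq0 (fD _) (fD _)) ee mulrnBl.
  by ncring.
have fP i : f (P i) = f (e i) by rewrite rmorphB fD subr0.
exists P; split=> //.
have /sq0 sP : f (1 - \sum_i P i) = 0.
  by rewrite rmorphB rmorph_sum rmorph1 (eq_bigr _ (fun i _ => fP i)) fe1 subrr.
have idP : (\sum_i P i) * (\sum_i P i) = \sum_i P i.
  rewrite mulr_suml; apply: eq_bigr => i _; rewrite mulr_sumr (bigD1 i) //= PP eqxx.
  by rewrite big1 ?addr0 // => j ne; rewrite PP eq_sym (negbTE ne).
apply/eqP; rewrite eq_sym -subr_eq0 -[X in X == 0]mulr1.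
rewrite -[1 in X in _ * X](subrK (\sum_i P i)) mulrDr.
rewrite sP; last by rewrite rmorphB rmorph_sum rmorph1 (eq_bigr _ (fun i _ => fP i)) fe1 subrr.
by rewrite mulrBl mul1r idP subrr addr0.
Qed.
End Idempotents.

Section Arrows.
Variables (V Ar : finType) (s r : Ar -> V) (P : V -> T) (a b : Ar -> T).
Hypothesis PP : forall i j, P i * P j = P i *+ (i == j).
Hypotheses (fsa : forall x, f (P (s x)) * f (a x) = f (a x))
  (far : forall x, f (a x) * f (P (r x)) = f (a x))
  (frb : forall x, f (P (r x)) * f (b x) = f (b x))
  (fbs : forall x, f (b x) * f (P (s x)) = f (b x)).
Hypothesis fba : forall x y, f (b x) * f (a y) = f (P (r x)) *+ (x == y).

(** Only the ghost arrows need correcting: with H the sum of the A x * C x, the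
    element B x = C x (2 - H) is one step of Newton's iteration for a left inverse,
    and it is exact here.  The last relation comes for free: P i minus the sum
    over the arrows leaving i is an idempotent in the kernel, hence zero. *)
Lemma lift_CK_family : exists A B : Ar -> T,
  [/\ forall x, f (A x) = f (a x), forall x, f (B x) = f (b x),
    forall x, [/\ P (s x) * A x = A x, A x * P (r x) = A x,
                  P (r x) * B x = B x & B x * P (s x) = B x],
    forall x y, B x * A y = P (r x) *+ (x == y) &
    forall i, f (P i) = \sum_(x | s x == i) f (a x) * f (b x) ->
      P i = \sum_(x | s x == i) A x * B x].
Proof.
have PPi i : P i * P i = P i by rewrite PP eqxx.
pose A x := P (s x) * a x * P (r x); pose C x := P (r x) * b x * P (s x).
have sA x : P (s x) * A x = A x by rewrite /A !mulrA PPi.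
have rA x : A x * P (r x) = A x by rewrite /A -!mulrA PPi.
have rC x : P (r x) * C x = C x by rewrite /C !mulrA PPi.
have Cs x : C x * P (s x) = C x by rewrite /C -!mulrA PPi.
have fA x : f (A x) = f (a x) by rewrite !rmorphM fsa far.
have fC x : f (C x) = f (b x) by rewrite !rmorphM frb fbs.
pose W x y := C x * A y - P (r x) *+ (x == y).
have fW x y : f (W x y) = 0 by rewrite rmorphB rmorphM rmorphMn fA fC fba subrr.
have CA x y : C x * A y = P (r x) *+ (x == y) + W x y by rewrite /W addrC subrK.
have rW x y : P (r x) * W x y = W x y.
  by rewrite /W mulrBr mulrA rC mulrnAr PPi.
have Wr x y : W x y * P (r y) = W x y.
  rewrite /W mulrBl -mulrA rA mulrnAl PP; case: (eqVneq x y) => [->|_]; first by rewrite eqxx.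
  by rewrite !mulr0n.
pose H := \sum_x A x * C x.
have HP i : H * P i = \sum_(x | s x == i) A x * C x.
  rewrite mulr_suml [RHS]big_mkcond; apply: eq_bigr => x _.
  by rewrite -mulrA -(Cs x) -mulrA PP; case: eqVneq => _; rewrite ?mulr1n ?Cs ?mulr0.
have PH i : P i * H = \sum_(x | s x == i) A x * C x.
  rewrite mulr_sumr [RHS]big_mkcond; apply: eq_bigr => x _.
  rewrite mulrA -(sA x) !mulrA PP eq_sym.
  by case: eqVneq => [->|_]; rewrite ?mulr1n ?mulr0n ?mul0r.
pose B x := C x * (2%:R - H).
have rB x : P (r x) * B x = B x by rewrite /B mulrA rC.
have Bs x : B x * P (s x) = B x.
  rewrite /B -mulrA mulrBl HP -PH -[2%:R * _](commr_nat _ 2) -mulrBr mulrA Cs.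
  by [].
have BA x y : B x * A y = P (r x) *+ (x == y).
  have mul4 (p w p' w' : T) : (p + w) * (p' + w') = p * p' + p * w' + w * p' + w * w'.
    by ncring.
  have HA : C x * H * A y = P (r x) *+ (x == y) + W x y *+ 2.
    rewrite mulr_sumr mulr_suml.
    transitivity (\sum_z (P (r x) *+ (x == y) *+ (z == y)
                 + W x y *+ (z == x) + W x y *+ (z == y))).
      apply: eq_bigr => z _; rewrite mulrA -mulrA !CA.
      rewrite mul4 (sq0 (fW _ _) (fW _ _)) addr0.
      have -> : P (r x) *+ (x == z) * W z y = W x y *+ (z == x).
        by rewrite [z == x]eq_sym; case: (eqVneq x z) => [->|_]; rewrite ?mulr1n ?rW // !mulr0n mul0r.
      have -> : W x z * (P (r z) *+ (z == y)) = W x y *+ (z == y).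
        by case: (eqVneq z y) => [->|_]; rewrite ?mulr1n ?Wr // !mulr0n mulr0.
      case: (eqVneq z y) => [->|_]; rewrite ?mulr1n ?mulr0n ?mulr0 //.
      by case: (eqVneq x y) => [->|_]; rewrite ?mulr1n ?mulr0n ?PPi ?mul0r.
    have sum1 (w : T) (z : Ar) : \sum_t w *+ (t == z) = w.
      by rewrite (bigD1 z) //= eqxx big1 ?addr0 // => t /negbTE->.
    by rewrite !big_split /= !sum1 -addrA -(mulr2n (W x y)).
  rewrite /B mulrBr mulrBl HA mulr_natr mulrnAl CA mulrnDl opprD addrACA subrr.
  by rewrite addr0 mulr2n addrK.
have fB x : f (B x) = f (b x).
  have fCH : f (C x * H) = f (b x).
    rewrite rmorphM rmorph_sum fC mulr_sumr (bigD1 x) //= rmorphM fA fC mulrA fba.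
    rewrite eqxx frb big1 ?addr0 // => z ne.
    by rewrite rmorphM fA fC mulrA fba eq_sym (negbTE ne) mul0r.
  by rewrite /B mulrBr rmorphB fCH mulr_natr rmorphMn fC mulr2n addrK.
exists A, B; split=> // i fPi; pose G := \sum_(x | s x == i) A x * B x.
have fG : f G = f (P i).
  by rewrite rmorph_sum fPi; apply: eq_bigr => x _; rewrite rmorphM fA fB.
have PG : P i * G = G.
  by rewrite mulr_sumr; apply: eq_bigr => x /eqP <-; rewrite mulrA sA.
have GP : G * P i = G.
  by rewrite mulr_suml; apply: eq_bigr => x /eqP <-; rewrite -mulrA Bs.
have GG : G * G = G.
  rewrite {1}/G mulr_suml; apply: eq_bigr => x sx; rewrite mulr_sumr (bigD1 x) //=.
  rewrite mulrA -(mulrA (A x)) BA eqxx rA big1 ?addr0 // => y /andP[_ ne].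
  by rewrite mulrA -(mulrA (A x)) BA eq_sym (negbTE ne) mulr0 mul0r.
have D0 : f (P i - G) = 0 by rewrite rmorphB fG subrr.
apply/eqP; rewrite -subr_eq0 -/G -(sq0 D0 D0) mulrBl !mulrBr PPi PG GP GG.
by rewrite subrr subr0.
Qed.
End Arrows.
End SquareZeroLifting.

(** * The algebras L_oo and L(E) are quasi-free *)

Section Linf.
Variable k : fieldType.
Local Notation x_ i := (api (@Linf_rel k) (gen k (inl i))).
Local Notation y_ i := (api (@Linf_rel k) (gen k (inr i))).

Lemma Linf_yx i j : y_ i * x_ j = (i == j)%:R :> Linf k.
Proof. by rewrite -rmorphM /= (api_rel (LinfRel k i j)) rmorph_nat. Qed.

Lemma Linf_lift_rel (T : kalgType k) (g : (nat + nat)%type -> T) :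
  (forall i j, g (inr i) * g (inl j) = (i == j)%:R) ->
  forall u v, @Linf_rel k u v -> alg_lift g u = alg_lift g v.
Proof.
by move=> gyx _ _ [i j]; rewrite rmorphM !alg_lift_gen gyx rmorph_nat.
Qed.

Lemma Linf_quasi_free : quasi_free (Linf k).
Proof.
move=> T f fk /choice[h hK] sq0; pose X i := h (x_ i); pose Y i := h (y_ i).
have [|X' [Y' [fX fY YX]]] := @lift_dual_families _ _ f sq0 X Y.
  by move=> i j; rewrite !hK Linf_yx.
pose g u := match u with inl i => X' i | inr i => Y' i end.
have [||s [sk sK _]] := @presented_section k _ (@Linf_rel k) T f g fk.
- by case=> i /=; rewrite ?fX ?fY hK.
- exact: Linf_lift_rel.
by exists s.
Qed.

(** The relations are homogeneous when the first generator and its adjoint have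
    degrees 1 and -1 and all others degree 0. *)
Lemma Linf_derivation : exists d : {additive Linf k -> Linf k},
  [/\ is_derivation d, forall l, d (kscal l) = 0 & d (x_ 0) = x_ 0].
Proof.
pose w u : Linf k := match u with
  | inl i => x_ i *+ (i == 0)%N | inr i => - y_ i *+ (i == 0)%N end.
have [|d [dM dk dw]] := @presented_derivation k _ (@Linf_rel k) w.
  apply: Linf_lift_rel => i j.
  transitivity (((i == j)%:R, 0) : cocycle_ext (zero_cocycle (Linf k))); last first.
    by case: (i == j) => //; congr pair; rewrite /= oppr0.
  congr pair; first exact: Linf_yx.
  rewrite /= addr0 mulrnAr mulrnAl mulNr Linf_yx.
  by case: eqVneq => [->|_]; rewrite ?mulNrn ?addrN // !mul0rn subr0.
exists d; split=> //; exact: dw (inl 0%N).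
Qed.
End Linf.

(** Stated over an arbitrary ring, so that the lifting takes place between
    abstract rings and the presentation enters only at the end. *)
Record leavitt_family (E : quiver) (T : pzRingType) (p : vertex E -> T) (a b : arrow E -> T) := LeavittFamily {
  lf_pp : forall i j, p i * p j = p i *+ (i == j);
  lf_sa : forall x, p (src x) * a x = a x;
  lf_ar : forall x, a x * p (rng x) = a x;
  lf_rb : forall x, p (rng x) * b x = b x;
  lf_bs : forall x, b x * p (src x) = b x;
  lf_ba : forall x y, b x * a y = p (rng x) *+ (x == y);
  lf_ab : forall i, ~~ sink i -> p i = \sum_(x | src x == i) a x * b x;
  lf_1 : 1 = \sum_i p i
}.

Lemma lift_leavitt_family (E : quiver) (T S : pzRingType) (f : {rmorphism T -> S})
    (p : vertex E -> S) (a b : arrow E -> S) :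
  (forall s, exists u, f u = s) ->
  (forall x y, f x = 0 -> f y = 0 -> x * y = 0) -> leavitt_family p a b ->
  exists p' a' b', [/\ leavitt_family p' a' b', forall i, f (p' i) = p i,
    forall x, f (a' x) = a x & forall x, f (b' x) = b x].
Proof.
move=> /choice[h hK] sq0 [pp sa ar rb bs ba ab p1].
have [i j||P [fP PP P1]] := @lift_orthogonal_idempotents _ _ f sq0 _ (h \o p).
- by rewrite /= !hK pp.
- by rewrite p1; apply: eq_bigr => i _; rewrite /= hK.
have {}fP i : f (P i) = p i by rewrite fP /= hK.
have [|||||A [B [fA fB AB BA PAB]]] := @lift_CK_family _ _ f sq0 _ _ (@src E) (@rng E) P
  (h \o a) (h \o b) PP.
- by move=> x; rewrite fP /= hK sa.
- by move=> x; rewrite fP /= hK ar.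
- by move=> x; rewrite fP /= hK rb.
- by move=> x; rewrite fP /= hK bs.
- by move=> x y; rewrite fP /= !hK ba.
exists P, A, B; split=> [|//|x|x]; [|by rewrite fA /= hK|by rewrite fB /= hK].
split=> // [x|x|x|x|i ni]; try by case: (AB x).
apply: PAB; rewrite fP ab //.
by apply: eq_bigr => y _; rewrite /= !hK.
Qed.

Section Leavitt.
Variables (k : fieldType) (E : quiver).
Local Notation L := (leavitt k E).
Local Notation p_ i := (api (@leavitt_rel k E) (gen k (inl i))).
Local Notation a_ a := (api (@leavitt_rel k E) (gen k (inr (inl a)))).
Local Notation b_ a := (api (@leavitt_rel k E) (gen k (inr (inr a)))).

Lemma leavitt_gens : leavitt_family (fun i => p_ i : L) (fun x => a_ x) (fun x => b_ x).
Proof.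
split.
- by move=> i j; rewrite -rmorphM /= (api_rel (leavitt_vertex k i j)) rmorphMn.
- by move=> x; rewrite -rmorphM /= (api_rel (leavitt_src k (inl x : arrow (hat E)))).
- by move=> x; rewrite -rmorphM /= (api_rel (leavitt_rng k (inl x : arrow (hat E)))).
- by move=> x; rewrite -rmorphM /= (api_rel (leavitt_src k (inr x : arrow (hat E)))).
- by move=> x; rewrite -rmorphM /= (api_rel (leavitt_rng k (inr x : arrow (hat E)))).
- by move=> x y; rewrite -rmorphM /= (api_rel (leavitt_CK1 k x y)) rmorphMn.
- move=> i ni; apply: etrans (api_rel (leavitt_CK2 k ni)) _.
  apply: etrans (rmorph_sum (api _) _ _ _) _.
  by apply: eq_bigr => x _; rewrite rmorphM.
- apply: etrans (_ : api (@leavitt_rel k E) 1 = _); first by rewrite rmorph1.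
  by rewrite (api_rel (leavitt_unit k E)) rmorph_sum.
Qed.

Lemma leavitt_lift_rel (T : kalgType k) (g : (vertex E + arrow (hat E))%type -> T) :
  leavitt_family (fun i => g (inl i)) (fun x => g (inr (inl x)))
    (fun x => g (inr (inr x))) ->
  forall u v, @leavitt_rel k E u v -> alg_lift g u = alg_lift g v.
Proof.
case=> pp sa ar rb bs ba ab p1 _ _ [i j|[x|x]|[x|x]|x y|i ni|].
- by rewrite rmorphM rmorphMn /= !alg_lift_gen pp.
- by rewrite rmorphM /= !alg_lift_gen sa.
- by rewrite rmorphM /= !alg_lift_gen rb.
- by rewrite rmorphM /= !alg_lift_gen ar.
- by rewrite rmorphM /= !alg_lift_gen bs.
- by rewrite rmorphM rmorphMn /= !alg_lift_gen ba.
- rewrite rmorph_sum /= alg_lift_gen ab //; apply: eq_bigr => x _.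
  by rewrite rmorphM /= !alg_lift_gen.
- by rewrite rmorph1 rmorph_sum p1; apply: eq_bigr => i _; rewrite /= alg_lift_gen.
Qed.

Lemma leavitt_quasi_free : quasi_free L.
Proof.
move=> T f fk f_surj sq0.
have [P [A [B [PAB fP fA fB]]]] := lift_leavitt_family f_surj sq0 leavitt_gens.
pose g (u : vertex E + arrow (hat E)) : T := match u with
  | inl i => P i | inr (inl x) => A x | inr (inr x) => B x end.
have [||s [sk sK _]] := @presented_section k _ (@leavitt_rel k E) T f g fk.
- by case=> [i|[x|x]]; [exact: fP|exact: fA|exact: fB].
- exact: leavitt_lift_rel.
by exists s.
Qed.

(** The relations are homogeneous for the degree that counts the occurrences of x0
    minus those of its ghost. *)
Lemma leavitt_derivation (x0 : arrow E) : exists d : {additive L -> L},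
  [/\ is_derivation d, forall l, d (kscal l) = 0, forall i, d (p_ i) = 0
    & forall x, d (a_ x) = a_ x *+ (x == x0)].
Proof.
have [pp sa ar rb bs ba ab p1] := leavitt_gens.
pose w (u : vertex E + arrow (hat E)) : L := match u with
  | inl i => 0
  | inr (inl x) => a_ x *+ (x == x0)
  | inr (inr x) => - (b_ x *+ (x == x0)) end.
have jB : {morph (fun u => (u, 0) : cocycle_ext (zero_cocycle L)) : u v / u - v}.
  by move=> u v; congr pair; rewrite /= subr0.
have [|d [dM dk dw]] := @presented_derivation k _ (@leavitt_rel k E) w.
  apply: leavitt_lift_rel; split=> [i j|x|x|x|x|x y|i ni|].
  - rewrite -(raddfMn (additive_of jB)) /=; congr pair => /=; first exact: pp.
    by rewrite !(mulr0, mul0r, addr0).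
  - by congr pair; rewrite /= ?mul0r ?addr0 ?mulrnAr sa.
  - by congr pair; rewrite /= ?mulr0 ?add0r ?addr0 ?mulrnAl ar.
  - by congr pair; rewrite /= ?mul0r ?addr0 ?mulrN ?mulrnAr rb.
  - by congr pair; rewrite /= ?mulr0 ?add0r ?addr0 ?mulNr ?mulrnAl bs.
  - rewrite -(raddfMn (additive_of jB)) /=; congr pair => /=; first exact: ba.
    rewrite addr0 mulNr mulrnAl mulrnAr ba.
    by case: eqVneq => [->|_]; rewrite ?addrN // !mul0rn subr0.
  - rewrite (ab _ ni) [LHS](raddf_sum (additive_of jB)); apply: eq_bigr => x _ /=.
    congr pair; rewrite /= addr0 mulrN mulrnAr mulrnAl.
    by rewrite addNr.
  - rewrite -(raddf_sum (additive_of jB)) /= -p1; congr pair.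
    by rewrite /= oppr0.
by exists d.
Qed.

End Leavitt.

(** * Traces counting periodic points *)

Section WordFunctionals.
Variables (k : comPzRingType) (I : Type) (A : kalgType k) (w : seq I -> A).
Hypothesis w_ind : forall C : A -> Prop,
  C 0 -> (forall x y, C x -> C y -> C (x + y)) ->
  (forall c s, C (kscal c * w s)) -> forall x, C x.
Variables (f : {additive A -> k}) (t0 : seq I -> k).
Hypothesis fw : forall c s, f (kscal c * w s) = c * t0 s.

Lemma words_linear l x : f (kscal l * x) = l * f x.
Proof.
elim/w_ind: x => [|x y Hx Hy|c s]; first by rewrite mulr0 raddf0 mulr0.
  by rewrite mulrDr !raddfD Hx Hy mulrDr.
by rewrite mulrA -kscalM !fw mulrA.
Qed.

(** For a trace, the two-sided ideal generated by x - y may be tested on the left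
    multiples (x - y) w by words w. *)
Lemma words_trace_ideal x y : is_trace f -> (forall s, f (x * w s) = f (y * w s)) ->
  forall a b, f (a * (x - y) * b) = 0.
Proof.
move=> fC fxy a b; rewrite -mulrA fC -mulrA.
elim/w_ind: (b * a) => [|u v Hu Hv|c s]; first by rewrite mulr0 raddf0.
  by rewrite mulrDr raddfD Hu Hv addr0.
rewrite mulrA -kscalC -mulrA words_linear mulrBl raddfB fxy subrr.
by rewrite mulr0.
Qed.

End WordFunctionals.

Section QuotientTrace.
Variables (k : fieldType) (F : kalgType k) (rel : F -> F -> Prop).
Variable f : {additive F -> k}.
Hypotheses (fC : is_trace f) (fZ : forall l x, f (kscal l * x) = l * f x).
Hypothesis f_ideal : forall a x y b, rel x y -> f (a * (x - y) * b) = 0.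

Lemma aquot_lift_trace : is_trace (aquot_lift f_ideal).
Proof.
move=> t u; have [x ->] := api_surj t; have [y ->] := api_surj u.
by rewrite -!rmorphM !aquot_liftE fC.
Qed.

Lemma aquot_lift_linear l t : aquot_lift f_ideal (kscal l * t) = l * aquot_lift f_ideal t.
Proof.
by have [x ->] := api_surj t; rewrite -api_scal -rmorphM !aquot_liftE fZ.
Qed.

End QuotientTrace.

Section PresentedTrace.
Variables (k : fieldType) (I : choiceType) (rel : freeA k I -> freeA k I -> Prop).
Local Notation A := (aquot rel).
Variable t0 : seq I -> k.
Hypothesis t0C : forall s s', t0 (s ++ s') = t0 (s' ++ s).

Fact word_weightB (m : {fmonom I}) : {morph (fun c => c * t0 m) : a b / a - b}.
Proof. by move=> a b; rewrite mulrBl. Qed.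

Definition word_trace : {additive freeA k I -> k} := lin_ext word_weightB.

Lemma word_traceE c s : word_trace (kscal c * word k s) = c * t0 s.
Proof. exact: lin_extE. Qed.

Lemma word_trace_word s : word_trace (word k s) = t0 s.
Proof. by have := word_traceE 1 s; rewrite kscal1 !mul1r. Qed.

Lemma word_traceC : is_trace word_trace.
Proof.
apply: (words_trace (@freeA_ind k I) (@word_cat k I)); last exact: mulrC.
move=> c s s'; apply: etrans (word_traceE _ _) _.
by apply: etrans _ (esym (word_traceE _ _)); rewrite t0C.
Qed.

Lemma presented_trace :
  (forall x y, rel x y -> forall s, word_trace (x * word k s) = word_trace (y * word k s)) ->
  exists t : {additive A -> k}, [/\ is_trace t,
    forall l a, t (kscal l * a) = l * t a & forall s, t (api rel (word k s)) = t0 s].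
Proof.
move=> rel_t.
have vanish a x y b : rel x y -> word_trace (a * (x - y) * b) = 0.
  by move=> r; apply: (words_trace_ideal (@freeA_ind k I) word_traceE word_traceC (rel_t _ _ r)).
exists (aquot_lift vanish); split=> [|l t|s].
- by apply: aquot_lift_trace; exact: word_traceC.
- apply: aquot_lift_linear => {}l x.
  exact: (words_linear (@freeA_ind k I) word_traceE).
- by rewrite aquot_liftE word_trace_word.
Qed.

End PresentedTrace.

(** Letters act as partial maps, and words by composition, the last letter first.
    Rotating a word carries a fixed point to a fixed point of the rotated word, so
    the existence of fixed points is a cyclic invariant of words. *)
Section PeriodicPoints.
Variables (I : Type) (X : Type) (valid : X -> Prop) (act : I -> X -> option X).
Variables (deg : I -> int) (d : int).
Hypothesis act_valid : forall i x y, valid x -> act i x = Some y -> valid y.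

Definition word_act (s : seq I) (x : X) : option X :=
  foldr (fun i o => obind (act i) o) (Some x) s.

Definition word_deg (s : seq I) : int := \sum_(i <- s) deg i.

Lemma word_act_cat s s' x : word_act (s ++ s') x = obind (word_act s) (word_act s' x).
Proof.
rewrite /word_act foldr_cat -/(word_act s' x).
case: (word_act s' x) => //=; elim: s => //= i s ->; by [].
Qed.

Lemma word_act_valid s x y : valid x -> word_act s x = Some y -> valid y.
Proof.
move=> vx; elim: s y => [|i s IHs] y /=; first by case=> <-.
rewrite -/(word_act s x); case: (word_act s x) IHs => //= z /(_ z erefl).
exact: act_valid.
Qed.

Lemma word_deg_cat s s' : word_deg (s ++ s') = word_deg s + word_deg s'.
Proof. exact: big_cat. Qed.

Definition fixes (s : seq I) (x : X) : Prop :=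
  [/\ valid x, word_act s x = Some x & word_deg s = d].

Definition has_fix (s : seq I) : bool := `[< exists x, fixes s x >].

Lemma has_fixC s s' : has_fix (s ++ s') = has_fix (s' ++ s).
Proof.
suff imp u v : (exists x, fixes (u ++ v) x) -> exists x, fixes (v ++ u) x.
  by apply/asboolP/asboolP; exact: imp.
case=> x [vx]; rewrite word_act_cat; case Ev: (word_act v x) => [y|//] /= Eu Ed.
exists y; split; first exact: word_act_valid Ev.
  by rewrite word_act_cat Eu.
by rewrite word_deg_cat addrC -word_deg_cat.
Qed.

Lemma has_fix_catl u u' s : word_deg u = word_deg u' ->
  (forall x, valid x -> word_act u x = word_act u' x) ->
  has_fix (u ++ s) = has_fix (u' ++ s).
Proof.
move=> du uu'; congr asbool; apply/propext.
suff imp v v' : word_deg v = word_deg v' ->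
    (forall x, valid x -> word_act v x = word_act v' x) ->
    (exists x, fixes (v ++ s) x) -> exists x, fixes (v' ++ s) x.
  by split; apply: imp => // x vx; rewrite uu'.
move=> dv vv' [x [vx Ex Ed]]; exists x; split=> //; last first.
  by rewrite word_deg_cat -dv -word_deg_cat.
rewrite word_act_cat -Ex word_act_cat; case Es: (word_act s x) => [y|//] /=.
by rewrite vv' //; exact: word_act_valid Es.
Qed.

Lemma has_fix_none u s : (forall x, valid x -> word_act u x = None) ->
  has_fix (u ++ s) = false.
Proof.
move=> u0; apply/asboolP => -[x [vx]]; rewrite word_act_cat.
case Es: (word_act s x) => [y|//] /=; rewrite u0 //.
exact: word_act_valid Es.
Qed.

Lemma has_fix_test u (P : pred X) s : word_deg u = 0 ->
  (forall x, valid x -> word_act u x = if P x then Some x else None) ->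
  has_fix (u ++ s) = `[< exists2 x, fixes s x & P x >].
Proof.
move=> du uP; congr asbool; apply/propext; split.
  case=> x [vx]; rewrite word_act_cat word_deg_cat du add0r.
  case Es: (word_act s x) => [y|//] /=; rewrite uP; last exact: word_act_valid Es.
  by case: ifP => // Py [yx] ds; subst y; exists x.
case=> x [vx Es ds] Px; exists x; split=> //.
  by rewrite word_act_cat Es /= uP // Px.
by rewrite word_deg_cat du add0r.
Qed.

End PeriodicPoints.

Section Streams.
Variable Z : Type.
Implicit Types (w : nat -> Z) (al be : seq Z).

Definition scons (z : Z) w : nat -> Z := fun n => if n is n'.+1 then w n' else z.

Definition prepend al w : nat -> Z := foldr scons w al.

Lemma scons_eta w : scons (w 0) (w \o succn) = w.
Proof. by apply/funext; case. Qed.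

Lemma prepend_ge al w n : prepend al w (size al + n) = w n.
Proof. by elim: al. Qed.

Lemma prepend_lt al w w' n : (n < size al)%N -> prepend al w n = prepend al w' n.
Proof. by elim: al n => [|z al IH] [|n] //=; exact: IH. Qed.

Lemma prepend_nth z0 al w n : (n < size al)%N -> prepend al w n = nth z0 al n.
Proof. by elim: al n => [|z al IH] [|n] //=; exact: IH. Qed.

Lemma prepend_rcons al z w : prepend (rcons al z) w = prepend al (scons z w).
Proof. by rewrite /prepend foldr_rcons. Qed.

(** If w = be v = al v with al longer than be, the first letters of w are those of
    al, and each later letter is equal to an earlier one. *)
Lemma prepend_fix_unique al be w w' : (size be < size al)%N ->
  (exists v, w = prepend be v /\ w = prepend al v) ->
  (exists v, w' = prepend be v /\ w' = prepend al v) -> w = w'.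
Proof.
move=> lt [v [wb wa]] [v' [wb' wa']]; apply/funext => n.
elim/ltn_ind: n => n IHn.
have [na|an] := ltnP n (size al).
  by rewrite wa wa'; exact: prepend_lt.
rewrite -(subnKC an); set m := (n - size al)%N.
have -> : w (size al + m)%N = w (size be + m)%N.
  by rewrite {1}wa wb !prepend_ge.
have -> : w' (size al + m)%N = w' (size be + m)%N.
  by rewrite {1}wa' wb' !prepend_ge.
apply: IHn; rewrite -(subnKC an) -/m ltn_add2r //.
Qed.

End Streams.

Section WordAlgebra.
Variables (k : fieldType) (I : choiceType).

Lemma gen_word (i : I) : gen k i = word k [:: i].
Proof. by rewrite /word big_seq1. Qed.

End WordAlgebra.

Section LinfTrace.
Variable k : fieldType.
Local Notation x_ i := (api (@Linf_rel k) (gen k (inl i))).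

Definition Linf_act (u : nat + nat) (w : nat -> nat) : option (nat -> nat) :=
  match u with
  | inl i => Some (scons i w)
  | inr i => if w 0%N == i then Some (w \o succn) else None
  end.

Definition Linf_deg (u : nat + nat) : int := if u is inl _ then 1 else -1.

Lemma Linf_trace : exists t : {additive Linf k -> k},
  [/\ is_trace t, forall l a, t (kscal l * a) = l * t a & t (x_ 0%N) = 1].
Proof.
have av (u : nat + nat) (w w' : nat -> nat) : True -> Linf_act u w = Some w' -> True.
  by [].
pose hf := has_fix (fun _ => True) Linf_act Linf_deg 1.
pose t0 s : k := (hf s)%:R.
have t0C s s' : t0 (s ++ s') = t0 (s' ++ s) by rewrite /t0 /hf (has_fixC _ _ av).
have [_ _ [i j] s|t [tC tZ tw]] := presented_trace (rel := @Linf_rel k) t0C.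
  rewrite !gen_word -word_cat -word_cat word_trace_word /t0 /hf.
  have actE w : word_act Linf_act [:: inr i; inl j] w = if j == i then Some w else None.
    by [].
  have [<-|ne] := eqVneq i j.
    rewrite mul1r word_trace_word; congr (_%:R); congr nat_of_bool.
    apply: (has_fix_catl _ av s (u' := [::])) => [|w _]; last by rewrite /word_act /= eqxx.
    by rewrite /word_deg !big_cons big_nil /= addr0 addNr.
  rewrite mul0r raddf0 (has_fix_none _ _ av) // => w _.
  by rewrite actE eq_sym (negbTE ne).
exists t; split=> //; rewrite gen_word tw /t0.
suff -> : hf [:: inl 0%N] by [].
apply/asboolP; exists (fun _ => 0%N); split=> //.
  by rewrite /word_act /=; congr Some; apply/funext; case.
by rewrite /word_deg big_seq1.
Qed.

Lemma Linf_eigen_trace : eigen_trace (Linf k).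
Proof.
have [d [dM dk dx]] := Linf_derivation k; have [t [tC tZ tx]] := Linf_trace.
by exists d, t, (x_ 0%N).
Qed.
End LinfTrace.

Section LeavittTrace.
Variables (k : fieldType) (E : quiver).
Local Notation L := (leavitt k E).
Local Notation a_ a := (api (@leavitt_rel k E) (gen k (inr (inl a)))).
Local Notation letter := (vertex E + arrow (hat E))%type.

Definition infinite_path (w : nat -> arrow E) : Prop :=
  forall n, rng (w n) = src (w n.+1).

(** The action of L(E) on infinite paths, restricted to generators. *)
Definition leavitt_act (u : letter) (w : nat -> arrow E) : option (nat -> arrow E) :=
  match u with
  | inl i => if src (w 0%N) == i then Some w else None
  | inr (inl x) => if rng x == src (w 0%N) then Some (scons x w) else None
  | inr (inr x) => if w 0%N == x then Some (w \o succn) else None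
  end.

Definition leavitt_deg (u : letter) : int :=
  match u with inl _ => 0 | inr (inl _) => 1 | inr (inr _) => -1 end.

Lemma leavitt_act_valid u w w' :
  infinite_path w -> leavitt_act u w = Some w' -> infinite_path w'.
Proof.
case: u => [i|[x|x]] /= wv; case: ifP => //= e [<-] // n; last exact: wv.
by case: n => [|n] /=; [exact/eqP|exact: wv].
Qed.

(** The pair (al, be) such that the word, where it is defined, acts as
    be w |-> al w.  Mismatched cancellations may return anything, as the word then
    acts as the empty map. *)
Fixpoint word_nf (s : seq letter) : seq (arrow E) * seq (arrow E) :=
  match s with
  | [::] => ([::], [::])
  | inl i :: s' => word_nf s'
  | inr (inl x) :: s' => (x :: (word_nf s').1, (word_nf s').2)
  | inr (inr x) :: s' => match word_nf s' with
      | (_ :: al, be) => (al, be) | ([::], be) => ([::], rcons be x) end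
  end.

Lemma word_nf_deg s :
  word_deg leavitt_deg s = (size (word_nf s).1)%:Z - (size (word_nf s).2)%:Z.
Proof.
rewrite /word_deg; elim: s => [|[i|[x|x]] s IH] /=; rewrite ?big_nil ?big_cons // IH.
- by rewrite add0r.
- by rewrite /= intS addrA.
- case: (word_nf s) => [[|y al] be] /=; first by rewrite size_rcons intS opprD addrCA.
  by rewrite intS addrA addKr.
Qed.

Lemma word_nfP s w w' : word_act leavitt_act s w = Some w' ->
  exists v, w = prepend (word_nf s).2 v /\ w' = prepend (word_nf s).1 v.
Proof.
elim: s w' => [|u s IH] w' /=; first by case=> <-; exists w.
rewrite -/(word_act leavitt_act s w); case: (word_act _ s w) IH => //= y /(_ y erefl).
case: (word_nf s) => al be [v [/= wv yv]].
case: u => [i|[x|x]] /=; case: ifP => // e [<-].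
- by exists v.
- by exists v; rewrite /= yv.
move/eqP in e; case: al yv => [|z al] yv /=.
  by exists (v \o succn); rewrite prepend_rcons -e yv /= scons_eta.
by exists v; rewrite yv.
Qed.

Section Degree.
Variable d : nat.
Hypothesis d_gt0 : (0 < d)%N.

Local Notation fixes := (fixes infinite_path leavitt_act leavitt_deg d%:Z).
Local Notation has_fix := (has_fix infinite_path leavitt_act leavitt_deg d%:Z).

(** A word of degree d > 0 acts as be w |-> al w with al longer than be by d. *)
Lemma fixes_unique s w w' : fixes s w -> fixes s w' -> w = w'.
Proof.
case=> _ /word_nfP Ew Ed [_ /word_nfP Ew' _]; apply: prepend_fix_unique Ew Ew'.
move: Ed; rewrite word_nf_deg => /eqP; rewrite subr_eq => /eqP[->].
by rewrite -[X in (X < _)%N]add0n ltn_add2r.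
Qed.

(** The words u j cut the paths into disjoint pieces according to h.  By uniqueness
    of the fixed path, at most one piece contributes; this is where the nonzero
    degree enters. *)
Lemma sum_has_fix (J : finType) (Q : pred J) (h : (nat -> arrow E) -> J)
    (u : J -> seq letter) s :
  (forall j, word_deg leavitt_deg (u j) = 0) ->
  (forall j w, infinite_path w ->
     word_act leavitt_act (u j) w = if h w == j then Some w else None) ->
  \sum_(j | Q j) (has_fix (u j ++ s))%:R
    = (`[< exists2 w, fixes s w & Q (h w) >])%:R :> k.
Proof.
move=> du uh.
have hf j : has_fix (u j ++ s) = `[< exists2 w, fixes s w & h w == j >].
  by apply: (has_fix_test _ leavitt_act_valid s (du j)) => w vw; exact: uh.
under eq_bigr do rewrite hf.
have [[w0 fw0]|no] := pselect (exists w, fixes s w).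
  have E1 (P : pred (nat -> arrow E)) : `[< exists2 w, fixes s w & P w >] = P w0.
    apply/asboolP/idP => [[w fw Pw]|Pw]; last by exists w0.
    by rewrite (fixes_unique fw0 fw).
  under eq_bigr do rewrite (E1 (fun w => h w == _)).
  rewrite (E1 (fun w => Q (h w))); case Qh: (Q (h w0)).
    by rewrite (bigD1 (h w0)) //= eqxx big1 ?addr0 // => j /andP[_ /negbTE]; rewrite eq_sym => ->.
  by apply: big1 => j Qj; case: eqVneq => // e; rewrite e Qj in Qh.
have E0 (P : pred (nat -> arrow E)) : `[< exists2 w, fixes s w & P w >] = false.
  by apply/asboolP => -[w fw _]; apply: no; exists w.
by rewrite E0 big1 // => j _; rewrite (E0 (fun w => h w == j)).
Qed.

Definition fix_weight (s : seq letter) : k := (has_fix s)%:R.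

Lemma fix_weightC s s' : fix_weight (s ++ s') = fix_weight (s' ++ s).
Proof. by rewrite /fix_weight (has_fixC _ _ leavitt_act_valid). Qed.

Local Notation tr := (word_trace fix_weight).
Local Notation word := (word k).

Lemma tr_act_eq u u' s : word_deg leavitt_deg u = word_deg leavitt_deg u' ->
  (forall w, infinite_path w -> word_act leavitt_act u w = word_act leavitt_act u' w) ->
  tr (word (u ++ s)) = tr (word (u' ++ s)).
Proof.
move=> du uu'; rewrite !word_trace_word /fix_weight.
by rewrite (has_fix_catl _ leavitt_act_valid s du uu').
Qed.

Lemma tr_act_none u s : (forall w, infinite_path w -> word_act leavitt_act u w = None) ->
  tr (word (u ++ s)) = 0.
Proof.
move=> u0; rewrite word_trace_word /fix_weight.
by rewrite (has_fix_none _ _ leavitt_act_valid s u0).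
Qed.

Lemma leavitt_rel_trace f g : @leavitt_rel k E f g ->
  forall s, tr (f * word s) = tr (g * word s).
Proof.
have deg2 u v : word_deg leavitt_deg [:: u; v] = leavitt_deg u + leavitt_deg v.
  by rewrite /word_deg !big_cons big_nil addr0.
have deg1 u : word_deg leavitt_deg [:: u] = leavitt_deg u.
  by rewrite /word_deg big_seq1.
case=> [i j|x|x|x y|i ni|] s; rewrite ?gen_word -?word_cat.
- have [<-|ne] := eqVneq i j.
    rewrite mulr1n -word_cat; apply: tr_act_eq => [|w _]; first by rewrite deg2 deg1 addr0.
    by rewrite /word_act /=; case: ifP => //= ->.
  rewrite mulr0n mul0r raddf0 tr_act_none // => w _.
  rewrite /word_act /=; case: ifP => //= /eqP->.
  by rewrite eq_sym (negbTE ne).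
- apply: tr_act_eq => [|w wv]; first by rewrite deg2 deg1 add0r.
  rewrite /word_act /=; case: x => x /=; case: ifP => //= e; first by rewrite eqxx.
  by rewrite -(eqP e) wv eqxx.
- apply: tr_act_eq => [|w wv]; first by rewrite deg2 deg1 addr0.
  rewrite /word_act /=; case: x => x /=; case: ifP => //= e; last first.
    by case: ifP => // e'; rewrite (eqP e') eqxx in e.
  by rewrite eq_sym e.
- have [<-|ne] := eqVneq x y.
    rewrite mulr1n -word_cat; apply: tr_act_eq => [|w wv]; first by rewrite deg2 deg1.
    by rewrite /word_act /= eq_sym; case: ifP => //= _; rewrite eqxx.
  rewrite mulr0n mul0r raddf0 tr_act_none // => w wv.
  by rewrite /word_act /=; case: ifP => //= _; rewrite eq_sym (negbTE ne).
- rewrite mulr_suml raddf_sum.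
  rewrite word_trace_word /fix_weight.
  have H x : tr (gen k (inr (inl x)) * gen k (inr (inr x)) * word s)
      = (has_fix ([:: inr (inl x); inr (inr x)] ++ s))%:R.
    by rewrite !gen_word -!word_cat word_trace_word.
  rewrite [RHS](eq_bigr _ (fun x _ => H x)).
  rewrite (sum_has_fix (h := fun w => w 0%N) (fun x => src x == i)) //.
  + congr (_%:R); congr nat_of_bool.
    by apply: (has_fix_test _ leavitt_act_valid s) => //; rewrite deg1.
  + move=> x w wv; rewrite /word_act /=; case: eqP => //= <-.
    by rewrite wv eqxx scons_eta.
- rewrite (mul1r (word s)) mulr_suml raddf_sum word_trace_word /fix_weight.
  have H i : tr (gen k (inl i) * word s) = (has_fix ([:: inl i] ++ s))%:R.
    by rewrite gen_word -word_cat word_trace_word.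
  rewrite [RHS](eq_bigr _ (fun i _ => H i)).
  rewrite (sum_has_fix (h := fun w => src (w 0%N)) xpredT) //.
  + congr (_%:R); congr nat_of_bool; congr asbool; apply/propext.
    by split=> [[w fw]|[w fw _]]; exists w.
Qed.

End Degree.

Section Cycle.
Variables (a : arrow E) (q : seq (arrow E)).
Local Notation comp := (fun x y : arrow E => rng x == src y).
Hypotheses (q_path : path comp a q) (q_closed : rng (last a q) = src a).

Local Notation letters := (map (fun x => inr (inl x) : letter)).

Lemma word_act_path x r w : path comp x r -> rng (last x r) = src (w 0%N) ->
  word_act leavitt_act (letters (x :: r)) w = Some (prepend (x :: r) w).
Proof.
elim: r x => [|y r IH] x /= => [_ ->|/andP[xy yr] lst]; first by rewrite /word_act /= eqxx.
by have := IH _ yr lst; rewrite /word_act /= => -> /=; rewrite xy.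
Qed.

Definition cycle_stream (n : nat) : arrow E := nth a (a :: q) (n %% (size q).+1).

Lemma cycle_stream_path : infinite_path cycle_stream.
Proof.
move=> n; rewrite /cycle_stream -[n.+1]addn1 -(modnDml n).
set m := (n %% _)%N; have: (m < (size q).+1)%N by rewrite ltn_mod.
rewrite ltnS leq_eqVlt => /predU1P[->|mq].
  by rewrite addn1 modnn /= -q_closed (last_nth a).
rewrite modn_small ?addn1 ?ltnS //=.
by have /(pathP a)/(_ m mq)/eqP := q_path.
Qed.

Lemma cycle_stream_fix : prepend (a :: q) cycle_stream = cycle_stream.
Proof.
apply/funext => n; have [nq|qn] := ltnP n (size (a :: q)).
  by rewrite (prepend_nth a) // /cycle_stream modn_small.
by rewrite -{1}(subnKC qn) prepend_ge /cycle_stream -{2}(subnKC qn) /= modnDl.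
Qed.

Lemma cycle_has_fix :
  has_fix infinite_path leavitt_act leavitt_deg (size (a :: q)) (letters (a :: q)).
Proof.
apply/asboolP; exists cycle_stream; split; first exact: cycle_stream_path.
  by rewrite word_act_path ?cycle_stream_fix //.
rewrite /word_deg big_map; elim: (a :: q) => [|x r IH]; first by rewrite big_nil.
by rewrite big_cons IH /= intS.
Qed.

(** As a occurs once in the closed path x, the derivation that counts a satisfies
    d x = x, and the periodic path x x x ... is the one fixed by x. *)
Lemma eigen_trace_cycle : a \notin q -> eigen_trace L.
Proof.
move=> aq; have [d [dM dk _ da]] := leavitt_derivation k a.
have [t [tC tZ tw]] := presented_trace (fix_weightC (size (a :: q)))
  (leavitt_rel_trace (ltn0Sn (size q))).
exists d, t, (api (@leavitt_rel k E) (word k (letters (a :: q)))); split=> //; last first.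
  by rewrite tw /fix_weight cycle_has_fix.
have -> : api (@leavitt_rel k E) (word k (letters (a :: q))) = a_ a * \prod_(x <- q) a_ x.
  by rewrite /word big_map rmorph_prod big_cons.
rewrite dM da eqxx mulr1n.
suff -> : d (\prod_(x <- q) a_ x) = 0 by rewrite mulr0 addr0.
elim: q aq => [|y r IH]; first by rewrite big_nil (derivation1 dM).
rewrite inE negb_or big_cons => /andP[/negbTE ay ar].
by rewrite dM da eq_sym ay mulr0n mul0r add0r IH // mulr0.
Qed.

End Cycle.

(** Cutting a closed path at the first return to its first arrow. *)
Lemma closed_path_first_return (a : arrow E) p :
  path (fun x y => rng x == src y) a p -> rng (last a p) = src a ->
  exists q, [/\ path (fun x y => rng x == src y) a q, rng (last a q) = src a & a \notin q].
Proof.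
have [n] := ubnP (size p); elim: n p => // n IH p; rewrite ltnS => pn pp lp.
have [ap|] := boolP (a \in p); last by exists p.
case/splitPr: ap pn pp lp => p1 p2; rewrite size_cat cat_path /= => pn /and3P[pp /eqP e _] _.
by apply: (IH p1) => //; apply: leq_trans pn; rewrite addnS ltnS leq_addr.
Qed.

Lemma leavitt_eigen_trace : has_closed_path E -> eigen_trace L.
Proof.
case=> a [p [pp lp]]; have [q [qp lq aq]] := closed_path_first_return pp lp.
exact: eigen_trace_cycle qp lq aq.
Qed.

End LeavittTrace.

Theorem proposition5p3 (k : fieldType) :
  (forall E : quiver, has_closed_path E ->
     ~ morita_equivalent (Linf k ⊗ leavitt k E)%type (leavitt k E))
  /\ ~ morita_equivalent (Linf k ⊗ Linf k)%type (Linf k).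
Proof.
split=> [E Ecyc|]; apply: eigen_trace_not_morita.
- exact: Linf_eigen_trace.
- exact: leavitt_eigen_trace.
- exact: leavitt_quasi_free.
- exact: Linf_eigen_trace.
- exact: Linf_eigen_trace.
- exact: Linf_quasi_free.
Qed.
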